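(* Let $\{\rho_\varepsilon\}_{\varepsilon>0}\subset L^1(\mathbb R^n)$ be a family of non-negative radial functions with $\|\rho_\varepsilon\|_{L^1(\mathbb R^n)}=1$ and $\lim_{\varepsilon\to0^+}\|\rho_\varepsilon\|_{L^1(\mathbb R^n\setminus B_\delta)}=0$ for all $\delta>0$. Let $T\in\mathscr D'(\mathbb R^n;V)$ be such that $\mathcal AT\in L^1(\mathbb R^n;W)$. Then $\mathfrak A_{\rho_\varepsilon}T\to\mathcal AT$ strongly in $L^1$ as $\varepsilon\to0^+$.
   Context: $V,W$ are finite-dimensional inner product spaces (identified with their duals), $A_1,\dots,A_n\in\mathrm{Hom}(V,W)$, and $\mathcal A=\sum_{i=1}^nA_i\partial_i:\mathscr D'(\mathbb R^n;V)\to\mathscr D'(\mathbb R^n;W)$, with symbol $\mathbb A(\xi)=\sum_iA_i\xi_i$ and formal adjoint $\mathcal A^*=-\sum_iA_i^t\partial_i$. $\mathscr D=C_c^\infty$. For a nonnegative integrable radial Borel function $\rho(x)=\hat\rho(|x|)$ and $u\in\mathscr D(\mathbb R^n;V)$, $$\mathfrak A_\rho u(x)=\lim_{\delta\to0^+}n\int_{\mathbb R^n\setminus B_\delta}\mathbb A\left(\frac{\xi}{|\xi|}\right)\left[\frac{u(x+\xi)-u(x)}{|\xi|}\right]\rho(\xi)\,d\xi,$$ and $\mathfrak A_\rho^*$ denotes the operator defined in the same way from $\mathcal A^*$. With $\mu_\rho(x)=\int_0^\infty n\hat\rho(r)1_{B_r}(x)\frac{dr}{r}$ one has $\mathfrak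 A_\rho^*\psi=\mathcal A^*(\mu_\rho\star\psi)$ for $\psi\in\mathscr D(\mathbb R^n;W)$. For $T\in\mathscr D'(\mathbb R^n;V)$ with $\mathcal AT\in L^1(\mathbb R^n;W)$, $\mathfrak A_\rho T\in\mathscr D'(\mathbb R^n;W)$ is defined by $\mathfrak A_\rho T(\psi)=T(\mathfrak A_\rho^*\psi)=T(\mathcal A^*(\mu_\rho\star\psi))$, understood as $\int\mathcal AT\cdot(\mu_\rho\star\psi)\,dx$. *)

(* Defs.v *)
From HB Require Import structures.
From mathcomp Require Import all_boot all_order all_algebra.
From mathcomp Require Import sesquilinear.
From mathcomp Require Import all_classical all_reals all_analysis.

Set Implicit Arguments.
Unset Strict Implicit.
Unset Printing Implicit Defensive.

Import Order.TTheory GRing.Theory Num.Theory.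
Import numFieldNormedType.Exports.

Local Open Scope classical_set_scope.
Local Open Scope ring_scope.

(* R^n is 'rV[R]_n with the sigma-algebra generated by the coordinates, i.e.
   the Borel sigma-algebra. *)
Definition rV_display : measure_display.
Proof. exact: default_measure_display. Qed.

Section measurable_rV.
Context {R : realType} (n : nat).

Let coors : 'I_n -> 'rV[R]_n -> measurableTypeR R := fun i x => x ord0 i.

Let rV_set0 : g_sigma_preimage coors set0.
Proof. exact: sigma_algebra0. Qed.

Let rV_setC A : g_sigma_preimage coors A -> g_sigma_preimage coors (~` A).
Proof. exact: sigma_algebraC. Qed.

Let rV_bigcup (F : (set 'rV[R]_n)^nat) :
  (forall i, g_sigma_preimage coors (F i)) ->
  g_sigma_preimage coors (\bigcup_i (F i)).
Proof. exact: sigma_algebra_bigcup. Qed.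

HB.instance Definition _ :=
  @isMeasurable.Build rV_display 'rV[R]_n
    (g_sigma_preimage coors) rV_set0 rV_setC rV_bigcup.

End measurable_rV.

Section lebesgue_rV.
Context {R : realType}.
Implicit Types n : nat.

Lemma measurable_coord n (i : 'I_n) :
  measurable_fun [set: 'rV[R]_n] (fun x => x ord0 i : measurableTypeR R).
Proof.
move=> _ Y mY; rewrite setTI; apply: sub_sigma_algebra => /=.
rewrite -bigcup_seq/=; exists i => /=; first by rewrite mem_index_enum.
by exists Y => //; rewrite setTI.
Qed.

Lemma measurable_fun_rVP d (T : measurableType d) n (f : T -> 'rV[R]_n) :
  (forall i, measurable_fun setT (fun x => f x ord0 i : measurableTypeR R)) ->
  measurable_fun setT f.
Proof.
move=> mf _ Y; rewrite setTI; move: Y; apply: smallest_sub => /=.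
  split => [|A mA|F mF] /=; first by rewrite preimage_set0.
    by rewrite setTD preimage_setC; exact: measurableC.
  by rewrite preimage_bigcup; exact: bigcup_measurable.
move=> A; rewrite -bigcup_seq/= => -[i _ [B mB <-]].
by have := mf i measurableT _ mB; rewrite !setTI.
Qed.

Definition cons_rV n (p : measurableTypeR R * 'rV[R]_n) : 'rV[R]_n.+1 :=
  row_mx (p.1%:M : 'rV[R]_1) p.2.

Lemma cons_rV0 n p : @cons_rV n p ord0 ord0 = p.1.
Proof.
transitivity (cons_rV p ord0 (lshift n ord0 : 'I_(1 + n))).
  by congr (cons_rV p _ _); exact/val_inj.
by apply: etrans (@row_mxEl _ 1 1 n p.1%:M p.2 ord0 ord0) _; rewrite mxE.
Qed.

Lemma cons_rVS n p i : @cons_rV n p ord0 (lift ord0 i) = p.2 ord0 i.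
Proof.
transitivity (cons_rV p ord0 (rshift 1 i : 'I_(1 + n))).
  by congr (cons_rV p _ _); exact/val_inj.
exact: (@row_mxEr _ 1 1 n p.1%:M p.2).
Qed.

Lemma measurable_cons_rV n : measurable_fun setT (@cons_rV n).
Proof.
apply: measurable_fun_rVP => i; have [j ->|->] := unliftP ord0 i.
  under eq_fun do rewrite cons_rVS.
  by apply: (measurableT_comp (@measurable_coord n j)); exact: measurable_snd.
by under eq_fun do rewrite cons_rV0; exact: measurable_fst.
Qed.

Definition lebesgue_cons n
    (mu : {sigma_finite_measure set 'rV[R]_n -> \bar R}) :=
  pushforward (lebesgue_measure \x mu)%E (@cons_rV n).

Section lebesgue_cons.
Variables (n : nat) (mu : {sigma_finite_measure set 'rV[R]_n -> \bar R}).
Local Open Scope ereal_scope.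

Let mpre A : measurable A -> measurable (@cons_rV n @^-1` A).
Proof.
by move=> mA; rewrite -[X in measurable X]setTI; exact: measurable_cons_rV.
Qed.

Let cons0 : lebesgue_cons mu set0 = 0.
Proof. by rewrite /lebesgue_cons /pushforward preimage_set0 measure0. Qed.

Let cons_ge0 A : 0 <= lebesgue_cons mu A.
Proof. by rewrite /lebesgue_cons /pushforward; exact: measure_ge0. Qed.

Let cons_sigma_additive : semi_sigma_additive (lebesgue_cons mu).
Proof.
move=> F mF tF mUF; rewrite /lebesgue_cons /pushforward preimage_bigcup.
apply: measure_semi_sigma_additive.
- by move=> k; exact: mpre.
- apply/trivIsetP => /= i j _ _ ij; rewrite -preimage_setI.
  by move/trivIsetP : tF => /(_ _ _ _ _ ij) ->//; rewrite preimage_set0.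
- by rewrite -preimage_bigcup; exact: mpre.
Qed.

HB.instance Definition _ := isMeasure.Build _ _ _ (lebesgue_cons mu)
  cons0 cons_ge0 cons_sigma_additive.

Let cons_sigma_finite : sigma_finite setT (lebesgue_cons mu).
Proof.
have [F TF mF] : sigma_finite setT (@lebesgue_measure R \x mu).
  have /sigma_finiteP[F [TF ndF Foo]] := sigma_finiteT (@lebesgue_measure R).
  have /sigma_finiteP[G [TG ndG Goo]] := sigma_finiteT mu.
  exists (fun k => F k `*` G k).
    rewrite -setXTT TF TG predeqE => -[x y]; split => /=.
      move=> [[k _ Fkx] [l _ Gly]]; exists (maxn k l) => //; split.
      - by move: x Fkx; exact/subsetPset/ndF/leq_maxl.
      - by move: y Gly; exact/subsetPset/ndG/leq_maxr.
    by move=> [k _ []/= ? ?]; split; exists k.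
  move=> k; have [? ?] := Foo k; have [? ?] := Goo k.
  split; first exact: measurableX.
  by rewrite product_measure1E// lte_mul_pinfty// ge0_fin_numE.
pose uncons (x : 'rV[R]_n.+1) : measurableTypeR R * 'rV[R]_n :=
  (x ord0 ord0, \row_i x ord0 (lift ord0 i)).
have consK : cancel (@cons_rV n) uncons.
  move=> [a v]; rewrite /uncons cons_rV0; congr pair.
  by apply/rowP => i; rewrite mxE cons_rVS.
have muncons : measurable_fun setT uncons.
  apply: measurable_fun_pair; first exact: measurable_coord.
  apply: measurable_fun_rVP => i; under eq_fun do rewrite mxE.
  exact: measurable_coord.
exists (fun k => uncons @^-1` F k).
  by rewrite -preimage_bigcup -TF preimage_setT.
move=> k; have [mFk Fkoo] := mF k; split.
  by rewrite -[X in measurable X]setTI; exact: muncons.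
rewrite /lebesgue_cons /pushforward -comp_preimage.
by rewrite (_ : uncons \o _ = id)//; apply/funext => p /=; rewrite consK.
Qed.

HB.instance Definition _ := Measure_isSigmaFinite.Build _ _ _
  (lebesgue_cons mu) cons_sigma_finite.

End lebesgue_cons.

(* Lebesgue measure on R^n, as the iterated product R * (R * ...). *)
Fixpoint leb n : {sigma_finite_measure set 'rV[R]_n -> \bar R} :=
  match n with
  | 0 => dirac (0 : 'rV[R]_0)
  | m.+1 => lebesgue_cons (leb m)
  end.

Lemma leb_box n (B : 'I_n -> set (measurableTypeR R)) :
  (forall i, measurable (B i)) ->
  leb n [set x | forall i, B i (x ord0 i)] =
  (\prod_(i < n) lebesgue_measure (B i))%E.
Proof.
elim: n B => [B _|n IH B mB].
  by rewrite big_ord0 /= diracE mem_set// => -[].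
rewrite big_ord_recl -IH => [|i]; last exact: mB.
rewrite -product_measure1E//; last first.
  rewrite [X in measurable X](_ : _ = \bigcap_(i in [set: 'I_n])
      ((fun x : 'rV[R]_n => x ord0 i) @^-1` B (lift ord0 i))).
    apply: fin_bigcap_measurable => // i _.
    by rewrite -[X in measurable X]setTI; exact: measurable_coord.
  by apply/seteqP; split => [x h i _|x h i]; exact: h.
rewrite /= /lebesgue_cons /pushforward; congr product_measure1.
apply/seteqP; split => [p h|p [h0 h] i].
  split=> [|i]; first by have := h ord0; rewrite /= cons_rV0.
  by have := h (lift ord0 i); rewrite /= cons_rVS.
by have [j ->|->] := unliftP ord0 i; rewrite ?cons_rVS ?cons_rV0//; exact: h.
Qed.

End lebesgue_rV.

Section inner_product_spaces.
Context {R : realType}.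

Definition vnorm (V : vectType R) (ip : {dot V for @idfun R}) (v : V) : R :=
  Num.sqrt (ip v v).

Definition adjoint (V W : vectType R) (ipV : {dot V for @idfun R})
    (ipW : {dot W for @idfun R}) (B : 'Hom(V, W)) : 'Hom(W, V) :=
  xget 0%R [set Bt : 'Hom(W, V) | forall v w, ipW (B v) w = ipV v (Bt w)].

Lemma adjointP (V W : vectType R) (ipV : {dot V for @idfun R})
    (ipW : {dot W for @idfun R}) (B : 'Hom(V, W)) v w :
  ipW (B v) w = ipV v (adjoint ipV ipW B w).
Proof.
rewrite /adjoint; case: xgetP => [_ _ ->//|nBt]; exfalso.
pose b := vbasis {:V}.
pose phi : V -> 'rV[R]_(\dim {:V}) := fun u => \row_i ipV b`_i u.
have phi_lin : linear phi.
  by move=> a x y; apply/rowP => i; rewrite !mxE linearP.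
pose phiL := GRing.isLinear.Build _ _ _ _ phi phi_lin.
pose Phi : {linear V -> 'rV[R]_(\dim {:V})} := HB.pack phi phiL.
pose f := linfun Phi.
have fE u i : f u ord0 i = ipV b`_i u by rewrite lfunE mxE.
have ext u (h : V -> R) (hl : linear h) :
    (forall i : 'I_(\dim {:V}), ipV b`_i u = h b`_i) -> forall v, ipV v u = h v.
  move=> bu {}v; pose hL := GRing.isLinear.Build _ _ _ _ h hl.
  pose H : {linear V -> R} := HB.pack h hL.
  rewrite (coord_vbasis (memvf v)) linear_sumlz/= -[h]/(H : V -> R) linear_sum.
  by apply: eq_bigr => i _; rewrite linearZl_LR linearZ/= bu.
have ker0 : lker f = 0%VS.
  apply/eqP; rewrite -subv0; apply/subvP => u; rewrite memv_ker memv0 => /eqP fu.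
  apply/contraT => u0; have := neq0_dnorm_gt0 (s := ipV) u u0.
  have -> : ipV u u = 0; last by rewrite ltxx.
  apply: (ext u (fun=> 0)) => [a x y|i]; first by rewrite [RHS]addr0 [RHS]mulr0.
  by rewrite -fE fu mxE.
have full : limg f = fullv.
  apply/eqP; rewrite eqEdim subvf limg_dim_eq ?ker0 ?capv0//.
  by rewrite [leqLHS]dimvf /dim/= mul1n.
pose c : W -> 'rV[R]_(\dim {:V}) := fun w => \row_i ipW (B b`_i) w.
have c_lin : linear c.
  by move=> a x y; apply/rowP => i; rewrite !mxE linearP.
pose cL := GRing.isLinear.Build _ _ _ _ c c_lin.
pose C : {linear W -> 'rV[R]_(\dim {:V})} := HB.pack c cL.
apply: (nBt (f^-1 \o linfun C)%VF) => {}v {}w /=; apply/esym.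
apply: (ext _ (fun v => ipW (B v) w)) => [a x y|i].
  by rewrite linearP linearPl.
have Cw : linfun C w \in limg f by rewrite full memvf.
rewrite -fE comp_lfunE limg_lfunVK //.
by rewrite (lfunE C) mxE.
Qed.

(* Derivatives and integrals of V-valued functions are taken componentwise:
   coordwise L f applies the real-valued operation L to each component of f in
   a fixed basis of V; for linear L the result does not depend on the basis. *)
Definition coordwise (V : vectType R) (T : Type) (L : (T -> R) -> R)
    (f : T -> V) : V :=
  \sum_(j < \dim {:V}) L (fun x => coord (vbasis {:V}) j (f x)) *:
    (vbasis {:V})`_j.

End inner_product_spaces.

Section distributions.
Context {R : realType} {n : nat}.
Implicit Types V : vectType R.

Definition enorm (x : 'rV[R]_n) : R := Num.sqrt (\sum_i x ord0 i ^+ 2).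

Definition eball (r : R) : set 'rV[R]_n := [set x | enorm x < r].

Definition partial_derivative (i : 'I_n) (h : 'rV[R]_n -> R) : 'rV[R]_n -> R :=
  fun x => 'D_(delta_mx ord0 i : 'rV[R]_n) h x.

Definition partials (s : seq 'I_n) (h : 'rV[R]_n -> R) : 'rV[R]_n -> R :=
  foldr partial_derivative h s.

Definition smooth (h : 'rV[R]_n -> R) :=
  forall (s : seq 'I_n) (x : 'rV[R]_n), differentiable (partials s h) x.

Definition test_function V (f : 'rV[R]_n -> V) :=
  (forall j, smooth (fun x => coord (vbasis {:V}) j (f x))) /\
  compact (closure [set x | f x != 0]).

Definition Cnorm V (N : nat) (f : 'rV[R]_n -> V) : R :=
  sup [set t : R | exists (s : seq 'I_n) (j : 'I_(\dim {:V})) (x : 'rV[R]_n),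
    (size s <= N)%N /\
    t = `|partials s (fun y => coord (vbasis {:V}) j (f y)) x|].

(* V is identified with its dual, so that an element of D'(R^n; V) is a
   functional on V-valued test functions; the values of T elsewhere are
   irrelevant. *)
Definition is_distribution V (T : ('rV[R]_n -> V) -> R) :=
  (forall (a : R) (f g : 'rV[R]_n -> V), test_function f -> test_function g ->
     T (fun x => a *: f x + g x) = a * T f + T g) /\
  (forall K : set 'rV[R]_n, compact K -> exists (C : R) (N : nat),
     forall f : 'rV[R]_n -> V, test_function f -> [set x | f x != 0] `<=` K ->
       `|T f| <= C * Cnorm N f).

Definition vpartial V (i : 'I_n) (f : 'rV[R]_n -> V) (x : 'rV[R]_n) : V :=
  coordwise (fun h => partial_derivative i h x) f.

Definition vintegral V (f : 'rV[R]_n -> V) : V :=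
  coordwise (fun h => \int[leb n]_x h x)%R f.

Definition convolution V (h : 'rV[R]_n -> R) (f : 'rV[R]_n -> V)
    (x : 'rV[R]_n) : V :=
  vintegral (fun y => h (x - y) *: f y).

Definition L1norm V (ip : {dot V for @idfun R}) (f : 'rV[R]_n -> V) : \bar R :=
  Lnorm (leb n) 1%:E (fun x => (vnorm ip (f x))%:E).

Definition L1 V (ip : {dot V for @idfun R}) (f : 'rV[R]_n -> V) :=
  (forall j, measurable_fun setT (fun x => coord (vbasis {:V}) j (f x))) /\
  (L1norm ip f < +oo)%E.

Definition L1_density V (ip : {dot V for @idfun R})
    (T : ('rV[R]_n -> V) -> R) (g : 'rV[R]_n -> V) :=
  L1 ip g /\
  forall f, test_function f -> T f = (\int[leb n]_x ip (g x) (f x))%R.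

Definition density V (ip : {dot V for @idfun R}) (T : ('rV[R]_n -> V) -> R) :
    'rV[R]_n -> V :=
  xget (fun=> 0) [set g | L1_density ip T g].

(* The densities f e and g are unique up to null sets, so that asking for some
   densities or for all of them is the same. *)
Definition L1_cvg0 V (ip : {dot V for @idfun R})
    (F : R -> ('rV[R]_n -> V) -> R) (G : ('rV[R]_n -> V) -> R) :=
  exists (f : R -> 'rV[R]_n -> V) (g : 'rV[R]_n -> V),
    [/\ forall e, 0 < e -> L1_density ip (F e) (f e),
        L1_density ip G g &
        L1norm ip (fun x => f e x - g x) @[e --> 0^'+] --> 0%E].

End distributions.

Section nonlocal_operators.
Context {R : realType} {n : nat} {V W : vectType R}.
Variables (ipV : {dot V for @idfun R}) (ipW : {dot W for @idfun R}).
Variable A : 'I_n -> 'Hom(V, W).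

Definition calA_star (psi : 'rV[R]_n -> W) (x : 'rV[R]_n) : V :=
  - \sum_(i < n) adjoint ipV ipW (A i) (vpartial i psi x).

(* the distribution (sum_i A_i d_i) T *)
Definition calA (T : ('rV[R]_n -> V) -> R) (psi : 'rV[R]_n -> W) : R :=
  T (calA_star psi).

(* mu_rho for the radial function rho(x) = rhohat(|x|); the integral may
   diverge at x = 0, where the value is irrelevant. *)
Definition mu_rho (rhohat : R -> R) (x : 'rV[R]_n) : R :=
  (\int[lebesgue_measure]_(r in `]0%R, +oo[)
     (n%:R * rhohat r * \1_(eball r) x / r))%R.

(* For T with calA T in L^1, the value T (calA_star (mu_rho * psi)), where
   mu_rho * psi need not have compact support, is understood as the integral
   of calA T . (mu_rho * psi). *)
Definition frakA (rhohat : R -> R) (T : ('rV[R]_n -> V) -> R)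
    (psi : 'rV[R]_n -> W) : R :=
  (\int[leb n]_x
     ipW (density ipW (calA T) x) (convolution (mu_rho rhohat) psi x))%R.

End nonlocal_operators.

(* Main.v *)
Require Import Defs.
From HB Require Import structures.
From mathcomp Require Import all_boot all_order all_algebra.
From mathcomp Require Import sesquilinear.
From mathcomp Require Import all_classical all_reals all_analysis.
From mathcomp Require Import measurable_realfun.
From mathcomp Require Import ring lra.

Set Implicit Arguments.
Unset Strict Implicit.
Unset Printing Implicit Defensive.

Import Order.TTheory GRing.Theory Num.Theory.
Import numFieldNormedType.Exports.

Local Open Scope classical_set_scope.
Local Open Scope ring_scope.

(** For a test function psi the pairing frakA T (psi) is the integral of AT
    against mu_rho * psi, where AT is integrable and mu_rho is even. Fubini's
    theorem moves the convolution to the other factor, so that frakA T is the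
    integrable function mu_rho * AT ([vmollify_duality]), and the statement
    becomes the L1 convergence of the approximate identity mu_(rho_e) * g -> g
    for g = AT ([vmollify_cvg]).

    That the mu_(rho_e) do form an approximate identity is seen by exchanging
    the two integrals: the radius r contributes n rhohat(r) |B_r| / r to the
    integral of mu_rho, and n |B_r| / r is the area of the sphere of radius r,
    so that mu_rho and rho have the same integral ([integral_mu_rho]). Outside
    B_delta only the radii r > delta contribute, each by at most its full
    share, so that mu_rho has no more mass there than rho has
    ([integral_mu_rho_tail]). The polar coordinates used here amount to the
    distribution of |x| under Lebesgue measure, which is determined by the
    measures r^n |B_1| of the balls ([integral_radial]).

    The convergence rests on the bound
      ||mu * g - g||_1 <= int mu(h) ||g(. + h) - g||_1 dh
    ([mollify_dist_le]). For small h the shift distance is small because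
    translations are continuous in L1 ([shift_continuous_L1]); for large h it is
    at most 2 ||g||_1, and mu has little mass there. Continuity of translations
    is obtained for indicators of open sets of finite measure by dominated
    convergence, for measurable sets by Dynkin's theorem, and for integrable
    functions by density of the simple functions.

    Functions with values in W are handled through their coordinates in a basis,
    which are bounded by the norm and bound it ([coord_le_vnorm],
    [vnorm_le_coord]). *)

(** * Borel sets of R^n and coordinatewise changes of variables *)

(** The measure structure of a pushforward depends on a proof that the map is
    measurable, which unification cannot recover from the set function alone. *)
Definition image_measure d1 d2 (T1 : measurableType d1) (T2 : measurableType d2)
    (R : realType) (mu : {measure set T1 -> \bar R}) (f : T1 -> T2)
    (mf : measurable_fun setT f) : {measure set T2 -> \bar R} :=
  measure_function_pushforward__canonical__measure_function_Measure mu mf.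

Section borel_rV.
Context {R : realType}.
Implicit Types n : nat.

Definition measurable_boxes n : set_system 'rV[R]_n :=
  [set A | exists2 B : 'I_n -> set (measurableTypeR R),
     (forall i, measurable (B i)) & A = [set x : 'rV[R]_n | forall i, B i (x ord0 i)]].

Lemma measurable_box n (B : 'I_n -> set (measurableTypeR R)) :
  (forall i, measurable (B i)) ->
  measurable [set x : 'rV[R]_n | forall i, B i (x ord0 i)].
Proof.
move=> mB; rewrite [X in measurable X](_ : _ = \bigcap_(i in [set: 'I_n])
    ((fun x : 'rV[R]_n => x ord0 i) @^-1` B i)).
  apply: fin_bigcap_measurable => // i _.
  by rewrite -[X in measurable X]setTI; exact: measurable_coord.
by apply/seteqP; split => [x h i _|x h i]; exact: h.
Qed.

Lemma measurable_rV_generated n :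
  @measurable _ 'rV[R]_n = <<s @measurable_boxes n >>.
Proof.
apply/seteqP; split; last first.
  by apply: smallest_sub; [exact: sigma_algebra_measurable|
     move=> _ [B mB ->]; exact: measurable_box].
apply: smallest_sub => [|A]; first exact: smallest_sigma_algebra.
rewrite -bigcup_seq/= => -[i _ [B mB <-]].
apply: sub_sigma_algebra.
exists (fun j => if j == i then B else setT) => [j|].
  by case: ifP => // _; exact: measurableT.
rewrite setTI; apply/seteqP; split => x /= h.
  by move=> j; case: eqP => // ->.
by have := h i; rewrite eqxx.
Qed.

Lemma setI_closed_boxes n : setI_closed (@measurable_boxes n).
Proof.
move=> _ _ [B mB ->] [C mC ->]; exists (fun i => B i `&` C i).
  by move=> i; exact: measurableI.
apply/seteqP; split => x /=.
  by move=> [h k] i; split; [exact: h|exact: k].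
by move=> h; split=> i; have [] := h i.
Qed.


Lemma rV_cover n :
  \bigcup_k [set x : 'rV[R]_n | forall i, `]-k%:R, k%:R[%classic (x ord0 i)]
    = setT.
Proof.
apply/seteqP; split => // x _.
exists (Num.trunc (\sum_i `|x ord0 i|)).+1 => //= i.
rewrite in_itv/= -ltr_norml; apply: le_lt_trans (truncnS_gt _).
by rewrite (bigD1 i)//= lerDl sumr_ge0.
Qed.

Lemma leb_box_lty n (B : 'I_n -> set (measurableTypeR R)) :
  (forall i, measurable (B i)) ->
  (forall i, lebesgue_measure (B i) < +oo)%E ->
  (leb n [set x | forall i, B i (x ord0 i)] < +oo)%E.
Proof.
move=> mB Boo; rewrite leb_box//.
suff /andP[] : (0 <= \prod_(i < n) lebesgue_measure (B i) < +oo)%E by [].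
elim/big_ind : _ => [|x y /andP[x0 xoo] /andP[y0 yoo]|i _].
- by rewrite lee01 ltry.
- by rewrite mule_ge0// lte_mul_pinfty// ge0_fin_numE.
- by rewrite measure_ge0 Boo.
Qed.

Definition coordinatewise n (phi : 'I_n -> R -> R) (x : 'rV[R]_n) : 'rV[R]_n :=
  \row_i phi i (x ord0 i).

Section coordinatewise_maps.
Context {n : nat}.
Variables (phi : 'I_n -> R -> R) (c : R).
Hypothesis c_ge0 : 0 <= c.
Hypothesis mphi :
  forall i, measurable_fun setT (phi i : measurableTypeR R -> measurableTypeR R).
Hypothesis phi_leb : forall i (B : set (measurableTypeR R)), measurable B ->
  lebesgue_measure (phi i @^-1` B) = (c%:E * lebesgue_measure B)%E.

Let Phi := coordinatewise phi.

Lemma measurable_coordinatewise : measurable_fun setT (coordinatewise phi).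
Proof.
apply: measurable_fun_rVP => i; rewrite /coordinatewise; under eq_fun do rewrite mxE.
apply: (@measurableT_comp _ _ _ _ _ _
  (phi i : measurableTypeR R -> measurableTypeR R)) => //.
exact: measurable_coord.
Qed.

(** Both sides are measures in A and agree on the boxes, where the claim is the
    one-dimensional hypothesis in each factor; the boxes determine a measure. *)
Lemma leb_coordinatewise A : measurable A ->
  leb n (coordinatewise phi @^-1` A) = ((c ^+ n)%:E * leb n A)%E.
Proof.
have cn0 : 0 <= c ^+ n by exact: exprn_ge0.
pose Q k := [set x : 'rV[R]_n | forall i, `]-k%:R, k%:R[%classic (x ord0 i)].
have mPhi := measurable_coordinatewise.
rewrite -[RHS]/(mscale (NngNum cn0) (leb n) A) -[LHS]/(pushforward (leb n) Phi A).
apply: (measure_unique (@measurable_boxes n) Q) => //.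
- exact: measurable_rV_generated.
- exact: setI_closed_boxes.
- by move=> k; exists (fun=> `]-k%:R, k%:R[%classic).
- exact: rV_cover.
- move=> _ [B mB ->].
  rewrite -[LHS]/(leb n (Phi @^-1` _)) /mscale [X in _ = (_ * X)%E]leb_box//=.
  rewrite [X in leb n X = _](_ : _ =
      [set x : 'rV[R]_n | forall i, (phi i @^-1` B i) (x ord0 i)]); last first.
    by apply/seteqP; split => x /= h i; have := h i; rewrite mxE.
  rewrite (@leb_box _ n (fun i => phi i @^-1` B i)); last first.
    by move=> i; rewrite -[X in measurable X]setTI; exact: mphi.
  rewrite (eq_bigr (fun i => c%:E * lebesgue_measure (B i))%E); last first.
    by move=> i _; exact: phi_leb.
  rewrite big_split/=; congr (_ * _)%E.
  by rewrite big_const_ord; elim: {+}n => //= m ->; rewrite -EFinM exprS.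
- move=> k; rewrite -[X in (X < _)%E]/(leb n (Phi @^-1` _)).
  rewrite [X in leb n X](_ : _ =
      [set x : 'rV[R]_n | forall i,
        (phi i @^-1` `]-k%:R, k%:R[) (x ord0 i)]); last first.
    by apply/seteqP; split => x /= h i; have := h i; rewrite mxE.
  apply: (@leb_box_lty n (fun i => phi i @^-1` `]-k%:R, k%:R[)) => i.
    by rewrite -[X in measurable X]setTI; exact: mphi.
  rewrite phi_leb// lte_mul_pinfty ?lee_fin//.
  by rewrite lebesgue_measure_itv/=; case: ifP; rewrite ltry.
Qed.
End coordinatewise_maps.

End borel_rV.

Section affine_change_of_variables.
Context {R : realType}.
Implicit Types n : nat.
Local Notation mu := (@lebesgue_measure R).

Lemma lebesgue_measure_affine (a b : R) (B : set (measurableTypeR R)) :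
  0 < a -> measurable B ->
  mu ((fun t => a * t + b) @^-1` B) = ((a^-1)%:E * mu B)%E.
Proof.
move=> a0 mB; pose f : measurableTypeR R -> measurableTypeR R := fun t => a * t + b.
rewrite -[X in mu X]/(f @^-1` B).
have mf : measurable_fun setT (f : measurableTypeR R -> measurableTypeR R).
  by apply: measurable_funD => //; exact: mulrl_measurable.
suff -> : mu B = (a%:E * mu (f @^-1` B))%E.
  by rewrite muleA -EFinM mulVf ?gt_eqF// mul1e.
apply: (@lebesgue_measure_unique _
  (mscale (NngNum (ltW a0)) (image_measure mu mf))) => // _ [[x y] /= _ <-].
rewrite /mscale/= /pushforward 
  (_ : f @^-1` _ = `](x - b) / a, (y - b) / a]%classic); last first.
  apply/seteqP; split => t /=; rewrite !in_itv/= /f => /andP[h1 h2].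
    by rewrite ltr_pdivrMr// ler_pdivlMr// (mulrC t) ltrBlDr h1 lerBrDr h2.
  move: h1 h2; rewrite ltr_pdivrMr// ler_pdivlMr// (mulrC t) ltrBlDr lerBrDr.
  by move=> -> ->.
rewrite !lebesgue_measure_itv/= !lte_fin ltr_pM2r ?invr_gt0// ltrBlDr subrK.
case: ifPn => _; last by rewrite mule0.
by rewrite -!EFinB -EFinM; congr EFin; field; rewrite gt_eqF.
Qed.

Lemma measurable_shift n (a : 'rV[R]_n) :
  measurable_fun setT (fun x : 'rV[R]_n => x + a).
Proof.
apply: measurable_fun_rVP => i; under eq_fun do rewrite mxE.
by apply: measurable_funD => //; exact: measurable_coord.
Qed.

Lemma measurable_opp_rV n : measurable_fun setT (fun x : 'rV[R]_n => - x).
Proof.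
apply: measurable_fun_rVP => i; under eq_fun do rewrite mxE.
by apply: measurable_funN; exact: measurable_coord.
Qed.

Lemma measurable_subr_rV n :
  measurable_fun setT (fun z : 'rV[R]_n * 'rV[R]_n => z.1 - z.2).
Proof.
apply: measurable_fun_rVP => i; under eq_fun do rewrite !mxE.
by apply: measurable_funB; apply: (measurableT_comp (@measurable_coord R n i)).
Qed.

Lemma leb_shift n (a : 'rV[R]_n) A : measurable A ->
  leb n ((fun x : 'rV[R]_n => x + a) @^-1` A) = leb n A.
Proof.
move=> mA; rewrite (_ : (fun x : 'rV[R]_n => x + a) =
    coordinatewise (fun i t => t + a ord0 i)); last first.
  by apply/funext => x; apply/rowP => i; rewrite !mxE.
rewrite (@leb_coordinatewise _ _ _ 1)// ?expr1n ?mul1e// => i.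
  exact: measurable_funD.
move=> B mB; have := @lebesgue_measure_affine 1 (a ord0 i) _ ltr01 mB.
by rewrite invr1; under eq_fun do rewrite mul1r.
Qed.

Lemma leb_opp n A : measurable A ->
  leb n ((fun x : 'rV[R]_n => - x) @^-1` A) = leb n A.
Proof.
move=> mA; rewrite (_ : (fun x : 'rV[R]_n => - x) =
    coordinatewise (fun i => -%R)); last first.
  by apply/funext => x; apply/rowP => i; rewrite !mxE.
rewrite (@leb_coordinatewise _ _ _ 1)// ?expr1n ?mul1e// => i B mB.
by rewrite mul1e; exact: lebesgue_measureN.
Qed.

Lemma leb_scale n (a : R) (A : set 'rV[R]_n) : 0 < a -> measurable A ->
  leb n ((fun x : 'rV[R]_n => a *: x) @^-1` A) = (((a^-1) ^+ n)%:E * leb n A)%E.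
Proof.
move=> a0 mA; rewrite (_ : (fun x : 'rV[R]_n => a *: x) =
    coordinatewise (fun i t => a * t)); last first.
  by apply/funext => x; apply/rowP => i; rewrite !mxE.
rewrite (@leb_coordinatewise _ _ _ a^-1)// ?invr_ge0 ?ltW//.
  by move=> i; exact: mulrl_measurable.
move=> i B mB; have := @lebesgue_measure_affine a 0 _ a0 mB.
by under eq_fun do rewrite addr0.
Qed.

Lemma ge0_integral_shift n (a : 'rV[R]_n) (f : 'rV[R]_n -> \bar R) :
  measurable_fun setT f -> (forall x, 0 <= f x)%E ->
  (\int[leb n]_x f (x + a)%R = \int[leb n]_x f x)%E.
Proof.
move=> mf f0.
pose s (x : 'rV[R]_n) := x + a.
rewrite -[LHS]/(\int[leb n]_(x in s @^-1` setT) (f \o s) x)%E.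
rewrite -(ge0_integral_pushforward (measurable_shift a))//.
apply: eq_measure_integral; first exact: measurable_shift.
by move=> ma A mA _; exact: (leb_shift a mA).
Qed.

Lemma ge0_integral_opp n (f : 'rV[R]_n -> \bar R) :
  measurable_fun setT f -> (forall x, 0 <= f x)%E ->
  (\int[leb n]_x f (- x)%R = \int[leb n]_x f x)%E.
Proof.
move=> mf f0.
pose s (x : 'rV[R]_n) := - x.
rewrite -[LHS]/(\int[leb n]_(x in s @^-1` setT) (f \o s) x)%E.
rewrite -(ge0_integral_pushforward (@measurable_opp_rV n))//.
apply: eq_measure_integral; first exact: measurable_opp_rV.
by move=> mN A mA _; exact: (leb_opp mA).
Qed.

End affine_change_of_variables.

Section euclidean_norm.
Context {R : realType} {n : nat}.
Implicit Types x y : 'rV[R]_n.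

Lemma measurable_enorm : measurable_fun setT (@enorm R n).
Proof.
apply: (@measurableT_comp _ _ _ _ _ _ (@Num.sqrt R)) => //.
  by apply: continuous_measurable_fun; exact: sqrt_continuous.
apply: measurable_sum => i; apply: measurable_funX; exact: measurable_coord.
Qed.

Lemma enorm_ge0 x : 0 <= enorm x.
Proof. exact: sqrtr_ge0. Qed.

Lemma enormZ (a : R) x : enorm (a *: x) = `|a| * enorm x.
Proof.
rewrite /enorm -sqrtr_sqr -sqrtrM ?sqr_ge0// mulr_sumr; congr Num.sqrt.
by apply: eq_bigr => i _; rewrite mxE exprMn.
Qed.

Lemma enormN x : enorm (- x) = enorm x.
Proof. by rewrite -scaleN1r enormZ normrN1 mul1r. Qed.

Lemma coord_le_enorm x i : `|x ord0 i| <= enorm x.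
Proof.
rewrite /enorm -sqrtr_sqr ler_wsqrtr// (bigD1 i)//= lerDl sumr_ge0// => j _.
exact: sqr_ge0.
Qed.

Lemma measurable_eball (r : R) : measurable (@eball R n r).
Proof.
rewrite (_ : eball r = @enorm R n @^-1` `]-oo, r[%classic).
  by rewrite -[X in measurable X]setTI; exact: measurable_enorm.
by apply/seteqP; split => x /=; rewrite in_itv.
Qed.

Lemma leb_eball (r : R) : 0 < r ->
  leb n (@eball R n r) = ((r ^+ n)%:E * leb n (@eball R n 1))%E.
Proof.
move=> r0; rewrite (_ : eball r = (fun x : 'rV[R]_n => r^-1 *: x) @^-1` eball 1).
  by rewrite leb_scale ?invr_gt0 ?invrK//; exact: measurable_eball.
apply/seteqP; split => x /=; rewrite /eball/= enormZ gtr0_norm ?invr_gt0//.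
  by rewrite ltr_pdivrMl// mulr1.
by rewrite ltr_pdivrMl// mulr1.
Qed.

Lemma leb_eball_lty (r : R) : (leb n (@eball R n r) < +oo)%E.
Proof.
apply: (@le_lt_trans _ _ (leb n [set x | forall i, `[- r, r]%classic (x ord0 i)])).
  apply: le_measure; rewrite ?inE; [exact: measurable_eball| |].
    by apply: (@measurable_box _ n (fun=> `[- r, r]%classic)) => i.
  move=> x /= xr i; rewrite in_itv/= -ler_norml.
  by rewrite (le_trans (coord_le_enorm _ _))// ltW.
apply: (@leb_box_lty _ n (fun=> `[- r, r]%classic)) => // i.
by rewrite lebesgue_measure_itv/=; case: ifP; rewrite ltry.
Qed.

End euclidean_norm.

(** * Open sets generate the Borel sets of R^n *)

Section open_measurable_rV.
Context {R : realType} {n : nat}.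

(** The sigma-algebra comes from the coordinates, the topology from the sup norm;
    they are related by writing an open set as the union of the countably many
    boxes with rational centre and radius 1/(k+1) that it contains. *)
Lemma open_measurable_rV (U : set 'rV[R]_n) : open U -> measurable U.
Proof.
move=> oU.
pose box (q : 'rV[rat]_n * nat) := [set x : 'rV[R]_n | forall i,
  (fun t => `|ratr (q.1 ord0 i) - t| < q.2.+1%:R^-1) (x ord0 i)].
have mbox q : measurable (box q).
  apply: (@measurable_box _ n (fun i =>
    ball (ratr (q.1 ord0 i) : R) q.2.+1%:R^-1)) => i.
  exact: measurable_ball.
rewrite (_ : U = \bigcup_(q in [set q | box q `<=` U]) box q).
  rewrite bigcup_mkcond; apply: countable_bigcupT_measurable => [|q].
    exact: countableP.
  by case: ifP.
apply/seteqP; split => [x Ux|x [q /= qU qx]]; last exact: qU.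
have [e e0 xeU] : exists2 e : R, 0 < e & ball x e `<=` U.
  have /nbhs_ballP[e /= e0 xeU] : nbhs x U by exact: open_nbhs_nbhs.
  by exists e.
pose k := Num.trunc (2 / e).
have [c [kc c0 ce]] : exists c : R, [/\ k.+1%:R^-1 = c, 0 < c & 2 * c < e].
  exists k.+1%:R^-1; split; rewrite ?invr_gt0//.
  by rewrite ltr_pdivrMr// mulrC -ltr_pdivrMr//; exact: truncnS_gt.
have /choice[q qx] (i : 'I_n) : exists q : rat, `|ratr q - x ord0 i| < c.
  have /rat_in_itvoo[q] : x ord0 i - c < x ord0 i + c by lra.
  by rewrite in_itv/= => /andP[h1 h2]; exists q; rewrite ltr_norml; lra.
exists (\row_i q i, k) => /=; last by move=> i; rewrite mxE; have := qx i; rewrite -kc.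
move=> y; rewrite /box/= kc => qy; apply: xeU; split => // i j.
rewrite (ord1 i) /ball/=; have := qx j; have := qy j; rewrite mxE.
rewrite !ltr_norml; lra.
Qed.

Lemma continuous_measurable_rV (f : 'rV[R]_n -> R) :
  continuous f -> measurable_fun setT f.
Proof.
move=> /continuousP cf _; apply: (measurability _ (RGenOpens.measurableE R)) => //.
move=> _ [_ [a [b ->]] <-]; rewrite setTI; apply: open_measurable_rV; apply: cf.
exact: interval_open.
Qed.

End open_measurable_rV.

(** * Convergence to 0 of extended real functions *)

Lemma cvge0_near_lt {R : realType} {T : Type} {F : set_system T} {FF : Filter F}
    (f : T -> \bar R) (e : R) :
  (f x @[x --> F] --> 0)%E -> 0 < e -> \forall x \near F, (f x < e%:E)%E.
Proof.
move=> f0 e0.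
have : nbhs (0%E : \bar R) [set y | (y < e%:E)%E].
  by apply: open_ereal_lt'; rewrite lte_fin.
exact: f0.
Qed.

Lemma cvge0_le {R : realType} {T : Type} {F : set_system T} {FF : Filter F}
    (f : T -> \bar R) : (forall t, 0 <= f t)%E ->
  (forall e : R, 0 < e -> \forall t \near F, (f t <= e%:E)%E) ->
  (f t @[t --> F] --> 0)%E.
Proof.
move=> f0 fe; apply/fine_cvgP; split.
  apply: filterS (fe 1 ltr01) => t ft1.
  by rewrite ge0_fin_numE// (le_lt_trans ft1)// ltry.
apply/cvgrPdist_le => e e0; apply: filterS (fe e e0) => t fte.
rewrite sub0r normrN ger0_norm ?fine_ge0//= -lee_fin fineK//.
by rewrite ge0_fin_numE// (le_lt_trans fte)// ltry.
Qed.

(** * Continuity of translations in L1 *)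

Section shift_continuity.
Context {R : realType} {n : nat}.
Implicit Types (f g : 'rV[R]_n -> R) (h : 'rV[R]_n).
Local Notation mu := (leb n).
Local Open Scope ereal_scope.

Definition shift_dist f h : \bar R := \int[mu]_x (`|f (x + h)%R - f x|%R)%:E.

Definition shift_continuous f := forall e : R, (0 < e)%R ->
  exists2 d : R, (0 < d)%R & forall h, (enorm h < d)%R -> shift_dist f h <= e%:E.

Lemma measurable_comp_shift f h :
  measurable_fun setT f -> measurable_fun setT (fun x : 'rV[R]_n => f (x + h)%R).
Proof. by move=> mf; apply: measurableT_comp => //; exact: measurable_shift. Qed.

Lemma measurable_dist f g : measurable_fun setT f -> measurable_fun setT g ->
  measurable_fun setT (fun x => (`|f x - g x|%R)%:E).
Proof.
move=> mf mg; apply/measurable_EFinP; apply: measurableT_comp => //.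
exact: measurable_funB.
Qed.

Lemma integral_dist_triangle (f g k : 'rV[R]_n -> R) :
  measurable_fun setT f -> measurable_fun setT g -> measurable_fun setT k ->
  \int[mu]_x (`|f x - k x|%R)%:E <=
  \int[mu]_x (`|f x - g x|%R)%:E + \int[mu]_x (`|g x - k x|%R)%:E.
Proof.
move=> mf mg mk; rewrite -ge0_integralD//; try exact: measurable_dist.
apply: ge0_le_integral => //; first exact: measurable_dist.
  by apply: emeasurable_funD; exact: measurable_dist.
by move=> x _; rewrite -EFinD lee_fin ler_distD.
Qed.

Lemma integral_dist_shift f g h :
  measurable_fun setT f -> measurable_fun setT g ->
  \int[mu]_x (`|f (x + h) - g (x + h)|%R)%:E = \int[mu]_x (`|f x - g x|%R)%:E.
Proof.
move=> mf mg.
by apply: (ge0_integral_shift h (f := fun x => (`|f x - g x|%R)%:E)) => //;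
  exact: measurable_dist.
Qed.

Lemma integral_distC f g :
  \int[mu]_x (`|f x - g x|%R)%:E = \int[mu]_x (`|g x - f x|%R)%:E.
Proof. by apply: eq_integral => x _; rewrite distrC. Qed.

Lemma shift_dist_le2 f h : measurable_fun setT f ->
  shift_dist f h <= \int[mu]_x (`|f x|%R)%:E + \int[mu]_x (`|f x|%R)%:E.
Proof.
move=> mf; have m0 : measurable_fun [set: 'rV[R]_n] (fun=> 0%R : R) by [].
have E g : \int[mu]_x (`|g x|%R)%:E = \int[mu]_x (`|g x - 0|%R)%:E.
  by apply: eq_integral => x _; rewrite subr0.
rewrite (E f) -{1}(integral_dist_shift h mf m0) [X in _ + X]integral_distC.
by apply: (integral_dist_triangle (g := fun=> 0%R)) => //;
  exact: measurable_comp_shift.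
Qed.

Lemma shift_continuous0 : shift_continuous (fun _ : 'rV[R]_n => 0%R : R).
Proof.
move=> e e0; exists 1%R => // h _.
rewrite /shift_dist; under eq_integral do rewrite subrr normr0.
by rewrite integral0 lee_fin ltW.
Qed.

(** The L1 distance between f and g is also that between their translates, so
    f is within three small errors of its own translate. *)
Lemma shift_continuous_approx f : measurable_fun setT f ->
  (forall e : R, (0 < e)%R -> exists g, [/\ measurable_fun setT g,
     shift_continuous g & \int[mu]_x (`|f x - g x|%R)%:E <= e%:E]) ->
  shift_continuous f.
Proof.
move=> mf H e e0; have e3 : (0 < e / 3)%R by rewrite divr_gt0.
have [g [mg gc fg]] := H _ e3; have [d d0 gd] := gc _ e3.
exists d => // h hd.
have -> : e%:E = (e / 3)%:E + ((e / 3)%:E + (e / 3)%:E).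
  by rewrite -!EFinD; congr EFin; field.
apply: (le_trans (integral_dist_triangle (measurable_comp_shift h mf)
  (measurable_comp_shift h mg) mf)).
apply: leeD; first by rewrite integral_dist_shift.
apply: (le_trans (integral_dist_triangle (measurable_comp_shift h mg) mg mf)).
by apply: leeD; [exact: gd|rewrite integral_distC].
Qed.

Lemma shift_continuousD f g (a : R) :
  measurable_fun setT f -> measurable_fun setT g ->
  shift_continuous f -> shift_continuous g ->
  shift_continuous (fun x => f x + a * g x)%R.
Proof.
move=> mf mg fc gc e e0.
have e2 : (0 < e / 2)%R by rewrite divr_gt0.
have a1 : (0 < `|a| + 1)%R by rewrite ltr_wpDl.
have ea : (0 < e / 2 / (`|a| + 1))%R by rewrite divr_gt0.
have [d1 d10 fd] := fc _ e2; have [d2 d20 gd] := gc _ ea.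
exists (Num.min d1 d2); first by rewrite lt_min d10.
move=> h; rewrite lt_min => /andP[/fd fh /gd gh].
have mfh := measurable_comp_shift h mf; have mgh := measurable_comp_shift h mg.
have -> : e%:E = (e / 2)%:E + (`|a| + 1)%:E * (e / 2 / (`|a| + 1))%:E.
  by rewrite -EFinM -EFinD; congr EFin; field; rewrite gt_eqF.
apply: (@le_trans _ _ (shift_dist f h + (`|a| + 1)%:E * shift_dist g h)); last first.
  by apply: leeD => //; rewrite lee_pmul2l// ?lte_fin.
rewrite -ge0_integralZl//; last exact: measurable_dist.
rewrite -ge0_integralD//; first last.
- by apply: measurable_funeM; exact: measurable_dist.
- exact: measurable_dist.
apply: ge0_le_integral => //.
- apply: measurable_dist; last first.
    by apply: measurable_funD => //; exact: measurable_funM.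
  by apply: measurable_funD => //; exact: measurable_funM.
- apply: emeasurable_funD; first exact: measurable_dist.
  by apply: measurable_funeM; exact: measurable_dist.
- move=> x _; rewrite -EFinM -EFinD lee_fin.
  rewrite (_ : _ - _ = (f (x + h) - f x) + a * (g (x + h) - g x))%R; last by ring.
  apply: (le_trans (ler_normD _ _)); rewrite lerD2l normrM ler_wpM2r//.
  by rewrite lerDl.
Qed.

Lemma shift_continuous_dominated (f_ : nat -> 'rV[R]_n -> R) f g :
  (forall m, measurable_fun setT (f_ m)) -> measurable_fun setT f ->
  (forall m, shift_continuous (f_ m)) ->
  (forall x, f_ m x @[m --> \oo] --> f x) ->
  mu.-integrable setT (EFin \o g) -> (forall m x, `|f_ m x| <= g x)%R ->
  shift_continuous f.
Proof.
move=> mf_ mf f_c f_f ig f_g; apply: shift_continuous_approx => // e e0.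
have [|||//||_ dc _] := @dominated_convergence _ _ _ mu setT measurableT
   (fun m => EFin \o f_ m) (EFin \o f) (EFin \o g).
- by move=> m; apply/measurable_EFinP.
- exact/measurable_EFinP.
- by apply: aeW => x _; apply: cvg_EFin; [exact: nearW|exact: f_f].
- by apply: aeW => x m _; rewrite /= lee_fin.
have : \forall m \near \oo, \int[mu]_x `|(f_ m x)%:E - (f x)%:E| < e%:E.
  exact: cvge0_near_lt dc e0.
case=> m _ /(_ m (leqnn m)) /ltW fm; exists (f_ m); split => //.
by rewrite integral_distC.
Qed.

End shift_continuity.

Section open_sets_generate.
Context {R : realType} {n : nat}.

Lemma measurable_rV_open :
  @measurable _ 'rV[R]_n = <<s [set U : set 'rV[R]_n | open U] >>.
Proof.
apply/seteqP; split; last first.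
  apply: smallest_sub; first exact: sigma_algebra_measurable.
  exact: open_measurable_rV.
apply: smallest_sub => [|A]; first exact: smallest_sigma_algebra.
rewrite -bigcup_seq/= => -[i _ [B mB <-]]; rewrite setTI.
have : <<s @RGenOpens.G R >> B by rewrite -[<<s _ >>]RGenOpens.measurableE.
move: B {mB}; apply: smallest_sub => /=.
  split => [|B sB|F sF] /=; first by rewrite preimage_set0; exact: sigma_algebra0.
    by rewrite setTD preimage_setC; exact: sigma_algebraC.
  by rewrite preimage_bigcup; exact: sigma_algebra_bigcup.
move=> _ [a [b ->]]; apply: sub_sigma_algebra => /=.
have /continuousP : continuous (fun x : 'rV[R]_n => x ord0 i).
  by move=> x; exact: coord_continuous.
by apply; exact: interval_open.
Qed.

Lemma setI_closed_open : setI_closed [set U : set 'rV[R]_n | open U].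
Proof. by move=> U V; exact: openI. Qed.

End open_sets_generate.

Section indicators.
Context {R : realType} {n : nat}.
Implicit Types (U A : set 'rV[R]_n).
Local Notation mu := (leb n).
Local Open Scope ereal_scope.

Lemma integrable_indic_lty A : measurable A -> mu A < +oo ->
  mu.-integrable setT (EFin \o (\1_A : 'rV[R]_n -> R)).
Proof.
move=> mA Aoo; apply/integrableP; split; first exact/measurable_EFinP.
rewrite (eq_integral (fun x => (\1_A x)%:E)) ?integral_indic ?setIT//.
by move=> x _; rewrite gee0_abs// lee_fin.
Qed.

(** The measure of the points of U that the translation by h moves out of U. The
    distance between the indicators of U and of its translate is the sum of this
    measure for h and for - h. *)
Let exit_mass U (h : 'rV[R]_n) : \bar R :=
  \int[mu]_x (\1_U x * (1 - \1_U (x + h)%R))%:E.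

Let measurable_exit U h : measurable U ->
  measurable_fun setT (fun x : 'rV[R]_n => (\1_U x * (1 - \1_U (x + h)%R) : R)%R%:E).
Proof.
move=> mU; apply/measurable_EFinP; apply: measurable_funM => //.
apply: measurable_funB => //.
by apply: (@measurable_comp_shift _ _ (\1_U)).
Qed.

(** A point of U stays in U under small translations because U is open, so the
    integrand tends to 0 pointwise along any sequence of shifts tending to 0,
    and it is dominated by the indicator of U. *)
Let exit_mass_small U (e : R) : open U -> mu U < +oo -> (0 < e)%R ->
  exists2 d : R, (0 < d)%R & forall h, (enorm h < d)%R -> exit_mass U h <= e%:E.
Proof.
move=> oU Uoo e0; apply: contrapT => H.
have mU := open_measurable_rV oU.
have /choice[h hP] : forall m : nat, exists h : 'rV[R]_n,
    (enorm h < m.+1%:R^-1)%R /\ e%:E < exit_mass U h.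
  move=> m; apply: contrapT => Hm; apply: H; exists m.+1%:R^-1%R.
    by rewrite invr_gt0.
  by move=> h hm; rewrite leNgt; apply/negP => he; apply: Hm; exists h.
have h0 : h m @[m --> \oo] --> (0%R : 'rV[R]_n).
  apply/cvgrPdist_lt => d d0; near=> m.
  rewrite sub0r normrN.
  rewrite [ltLHS]/Num.norm/= mx_normrE; apply/bigmax_ltP; split => // -[i j] _ /=.
  rewrite (ord1 i); apply: (le_lt_trans (coord_le_enorm _ _)).
  apply: (lt_trans (hP m).1).
  near: m; exact: near_infty_natSinv_lt (PosNum d0).
have [|||||_ _ dc] := @dominated_convergence _ _ _ mu setT measurableT
   (fun m x => (\1_U x * (1 - \1_U (x + h m)%R))%:E) (cst 0) (EFin \o \1_U).
- by move=> m; exact: measurable_exit.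
- by [].
- apply: aeW => x _; apply: cvg_near_cst.
  rewrite indicE; have [xU|_] := boolP (x \in U); last first.
    by apply: nearW => m; rewrite mul0r.
  have xh : (x + h m)%R @[m --> \oo] --> (x + 0)%R by apply: cvgD => //; exact: cvg_cst.
  rewrite addr0 in xh.
  have nU : nbhs (x : 'rV[R]_n) U := open_nbhs_nbhs (conj oU (set_mem xU)).
  have xhU : \forall m \near \oo, U (x + h m)%R := xh _ nU.
  apply: filterS xhU => m xhU; rewrite /=.
  by rewrite indicE mem_set// subrr mulr0.
- exact: integrable_indic_lty.
- apply: aeW => x m _; rewrite /= lee_fin ger0_norm// !indicE.
  by do 2 case: (_ \in _); rewrite /= ?(subrr, subr0, mulr0, mul0r, mulr1).
move: dc; rewrite integral0 => dc.
have [m _ /(_ m (leqnn m))] := cvge0_near_lt dc e0.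
by apply/negP; rewrite -leNgt; exact/ltW/(hP m).2.
Unshelve. all: by end_near. Qed.

Lemma shift_continuous_open U : open U -> mu U < +oo ->
  shift_continuous (\1_U : 'rV[R]_n -> R).
Proof.
move=> oU Uoo e e0; have mU := open_measurable_rV oU.
have e2 : (0 < e / 2)%R by rewrite divr_gt0.
have [d d0 dU] := exit_mass_small oU Uoo e2.
exists d => // h hd.
have -> : e%:E = (e / 2)%:E + (e / 2)%:E by rewrite -EFinD; congr EFin; field.
apply: (@le_trans _ _ (exit_mass U h + exit_mass U (- h))); last first.
  by apply: leeD; apply: dU => //; rewrite enormN.
(* the points entering U under h are the points leaving U under - h *)
rewrite {2}/exit_mass -(ge0_integral_shift h)//; last exact: measurable_exit.
rewrite -ge0_integralD//; first last.
- apply: (measurableT_comp (measurable_exit (- h)%R mU)).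
  exact: measurable_shift.
- exact: measurable_exit.
rewrite le_eqVlt; apply/orP; left; apply/eqP; apply: eq_integral => x _.
rewrite -EFinD addrK; congr EFin; rewrite !indicE.
by do 2 case: (_ \in _); rewrite /= ?(subrr, subr0, sub0r, normrN, mulr0,
  mul0r, mulr1, addr0, add0r, normr0, normr1).
Qed.

End indicators.

Section shift_continuity_L1.
Context {R : realType} {n : nat}.
Implicit Types (A : set 'rV[R]_n).
Local Notation mu := (leb n).
Local Open Scope ereal_scope.

Let Q (k : nat) : set 'rV[R]_n :=
  [set x | forall i, `](- k%:R)%R, k%:R[%classic (x ord0 i)].

Let mQ k : measurable (Q k).
Proof. exact: (@measurable_box _ n (fun=> `](- k%:R)%R, k%:R[%classic)). Qed.

Let Q_lty k : mu (Q k) < +oo.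
Proof.
apply: (@leb_box_lty _ n (fun=> `](- k%:R)%R, k%:R[%classic)) => // i.
by rewrite lebesgue_measure_itv/=; case: ifP; rewrite ltry.
Qed.

Let oQ k : open (Q k).
Proof.
rewrite (_ : Q k = \big[setI/setT]_(i < n)
    ((fun x : 'rV[R]_n => x ord0 i) @^-1` `](- k%:R)%R, k%:R[%classic)); last first.
  rewrite -bigcap_seq; apply/seteqP; split => [x h i _|x h i]; first exact: h.
  by apply: h; rewrite /= mem_index_enum.
elim/big_ind : _ => //; [exact: openT|exact: openI|].
move=> i _; have /continuousP : continuous (fun x : 'rV[R]_n => x ord0 i).
  by move=> x; exact: coord_continuous.
by apply; exact: interval_open.
Qed.

Let good k A := shift_continuous (\1_(A `&` Q k) : 'rV[R]_n -> R).

(** Dynkin's theorem for the sets A whose trace on a fixed open cube has a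
    translation-continuous indicator. The cube keeps all measures finite: it
    makes complements differences of integrable functions and dominates the
    partial unions of a disjoint sequence. *)
Lemma shift_continuous_indic_cube k A : measurable A -> good k A.
Proof.
rewrite measurable_rV_open.
move: A; apply: dynkin_induction.
- exact: measurable_rV_open.
- exact: setI_closed_open.
- by rewrite /good setTI; exact: shift_continuous_open.
- move=> U oU; apply: shift_continuous_open; first exact: openI.
  apply: le_lt_trans (Q_lty k); apply: le_measure; rewrite ?inE//.
  by apply: measurableI => //; exact: open_measurable_rV.
- move=> A mA gA; rewrite /good.
  rewrite (_ : \1_(~` A `&` Q k) = (fun x => \1_(Q k) x + (-1) * \1_(A `&` Q k) x)%R).
    apply: shift_continuousD => //.
    + by apply: measurable_indic; exact: measurableI.
    + exact: shift_continuous_open.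
  apply/funext => x; rewrite !indicE !in_setI in_setC.
  by case: (x \in A); case: (x \in Q k); rewrite /= ?mulr0 ?mulr1 ?addr0 ?subrr.
- move=> F mF tF gF.
  pose G N := \big[setU/set0]_(j < N) F j.
  have mG N : measurable (G N) by apply: bigsetU_measurable => i _; exact: mF.
  apply: (@shift_continuous_dominated _ _ (fun N => \1_(G N `&` Q k)) _ (\1_(Q k))).
  + by move=> N; apply: measurable_indic; exact: measurableI.
  + apply: measurable_indic; apply: measurableI => //.
    exact: bigcupT_measurable.
  + elim=> [|N IH].
      by rewrite /G big_ord0 set0I indic0; exact: shift_continuous0.
    rewrite (_ : \1_(G N.+1 `&` Q k) =
        (fun x => \1_(G N `&` Q k) x + 1 * \1_(F N `&` Q k) x)%R).
      by apply: shift_continuousD => //; try exact: gF;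
        apply: measurable_indic; exact: measurableI.
    apply/funext => x; rewrite !indicE !in_setI mul1r {1}/G big_ord_recr/= -/(G N).
    rewrite in_setU; have [xF|_] := boolP (x \in F N); last first.
      by rewrite orbF/= addr0.
    rewrite (_ : (x \in G N) = false) ?add0r//.
    apply/negP => /set_mem; rewrite /G -bigcup_mkord => GNx; have [j /= jN Fj] := GNx.
    move/trivIsetP : tF => /(_ j N I I); rewrite (ltn_eqF jN) => /(_ isT).
    by move=> /seteqP[+ _] => /(_ x); apply; split => //; exact: set_mem.
  + move=> x; apply: cvg_near_cst; have [[j _ Fj]|nF] := pselect ((\bigcup_j F j) x).
      exists j.+1 => // N /= jN; rewrite !indicE !in_setI.
      have -> : x \in G N by apply/mem_set; rewrite /G -bigcup_mkord; exists j.
      by have -> : x \in \bigcup_j F j by apply/mem_set; exists j.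
    apply: nearW => N; rewrite !indicE !in_setI.
    have /negbTE -> : x \notin G N.
      apply/negP => /set_mem; rewrite /G -bigcup_mkord => GNx.
      by have [j _ Fj] := GNx; apply: nF; exists j.
    by have /negbTE -> : x \notin \bigcup_j F j by apply/negP => /set_mem.
  + exact: integrable_indic_lty.
  + move=> N x; rewrite ger0_norm// !indicE in_setI.
    by case: (_ \in _); case: (_ \in _).
Qed.

Lemma shift_continuous_indic A : measurable A -> mu A < +oo ->
  shift_continuous (\1_A : 'rV[R]_n -> R).
Proof.
move=> mA Aoo.
apply: (@shift_continuous_dominated _ _ (fun k => \1_(A `&` Q k)) _ (\1_A)).
- by move=> k; apply: measurable_indic; exact: measurableI.
- by [].
- by move=> k; exact: shift_continuous_indic_cube.
- move=> x; apply: cvg_near_cst.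
  have [k _ xk] : (\bigcup_k Q k) x by rewrite rV_cover.
  exists k => // m /= km; rewrite !indicE in_setI (mem_set (_ : Q m x)) ?andbT//.
  move=> i; have := xk i; rewrite /= !in_itv/= => /andP[h1 h2].
  have kmR : (k%:R <= m%:R :> R)%R by rewrite ler_nat.
  by apply/andP; split; lra.
- exact: integrable_indic_lty.
- move=> k x; rewrite ger0_norm// !indicE in_setI.
  by case: (_ \in _); case: (_ \in _).
Qed.

Import HBSimple.

Lemma shift_continuous_sfun (g : {sfun 'rV[R]_n >-> R}) :
  mu.-integrable setT (EFin \o (g : 'rV[R]_n -> R)) ->
  shift_continuous (g : 'rV[R]_n -> R).
Proof.
move=> ig.
have [s gE] : exists s : seq R,
    (g : 'rV[R]_n -> R) = (fun x => \sum_(y <- s) y * \1_(g @^-1` [set y]) x)%R.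
  exists (finmap.enum_fset (fset_set (range g))).
  by apply/funext => x; rewrite fimfunE fsbig_finite.
rewrite gE; elim: s {gE} => [|y s IH].
  under eq_fun do rewrite big_nil; exact: shift_continuous0.
have -> : (fun x => \sum_(z <- y :: s) z * \1_(g @^-1` [set z]) x)%R =
    (fun x => \sum_(z <- s) z * \1_(g @^-1` [set z]) x +
      y * \1_(g @^-1` [set y]) x)%R.
  by apply/funext => x; rewrite big_cons addrC.
have mgy : measurable (g @^-1` [set y]).
  by rewrite -[X in measurable X]setTI; exact: measurable_funP.
have [->|y0] := eqVneq y 0%R.
  rewrite (_ : (fun x => _) = (fun x => \sum_(z <- s) z * \1_(g @^-1` [set z]) x)%R)//.
  by apply/funext => x; rewrite mul0r addr0.
apply: shift_continuousD => //.
  by apply: measurable_sum => z; apply: measurable_funM.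
apply: (shift_continuous_indic mgy).
(* the level set has finite measure since |g| >= |y| on it *)
have y0' : (0 < `|y|)%R by rewrite normr_gt0.
rewrite -(@lte_pmul2l _ `|y|%:E) ?lte_fin//.
rewrite gt0_muley ?lte_fin//.
have /integrableP[_] := ig; apply: le_lt_trans.
rewrite -[X in mu X]setIT -integral_indic// -ge0_integralZl//;
  last exact/measurable_EFinP/measurable_indic.
apply: ge0_le_integral => //.
- by apply: measurable_funeM; exact/measurable_EFinP/measurable_indic.
- apply: measurableT_comp => //; exact/measurable_EFinP.
- move=> x _; rewrite -EFinM /= lee_fin indicE.
  have [/set_mem/= ->|_] := boolP (_ \in _); first by rewrite mulr1.
  by rewrite mulr0.
Qed.

Lemma shift_continuous_L1 (f : 'rV[R]_n -> R) :
  mu.-integrable setT (EFin \o f) -> shift_continuous f.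
Proof.
move=> fi; have mf : measurable_fun setT f.
  by apply/measurable_EFinP; exact: measurable_int fi.
apply: shift_continuous_approx => // e e0.
have [g_ [ig _ gl]] := approximation_sfun_integrable measurableT fi.
have [m _ /(_ m (leqnn m)) gm] := cvge0_near_lt gl e0.
exists (g_ m : 'rV[R]_n -> R); split => //; first exact: shift_continuous_sfun.
exact: ltW gm.
Qed.

End shift_continuity_L1.

(** * Polar coordinates *)

Section integral_of_density.
Context d (T : measurableType d) (R : realType).
Variables (mu nu : {measure set T -> \bar R}) (w : T -> R).
Hypotheses (mw : measurable_fun setT w) (w0 : forall x, 0 <= w x).
Hypothesis nuE : forall A, measurable A -> nu A = (\int[mu]_(x in A) (w x)%:E)%E.
Local Open Scope ereal_scope.

Import HBNNSimple.

Let integral_density_nnsfun (g : {nnsfun T >-> R}) :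
  \int[nu]_x (g x)%:E = \int[mu]_x ((g x)%:E * (w x)%:E).
Proof.
have mg y : measurable (g @^-1` [set y]).
  by rewrite -[X in measurable X]setTI; exact: measurable_funP.
rewrite integralT_nnsfun sintegralE.
transitivity (\sum_(y \in range g)
    \int[mu]_x (y%:E * (\1_(g @^-1` [set y]) x)%:E * (w x)%:E)).
  apply: eq_fsbigr => y /set_mem[t _ gty].
  rewrite nuE//; under [RHS]eq_integral do rewrite -muleA.
  rewrite ge0_integralZl//; first last.
  - by rewrite lee_fin -gty.
  - by move=> x _; rewrite -EFinM lee_fin mulr_ge0.
  - by apply: emeasurable_funM; apply/measurable_EFinP => //; exact: measurable_indic.
  congr (_ * _); rewrite integral_mkcond; apply: eq_integral => x _.
  by rewrite epatch_indic muleC.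
rewrite -ge0_integral_fsum//; last 2 first.
- move=> y; apply: emeasurable_funM; last exact/measurable_EFinP.
  by apply: measurable_funeM; exact/measurable_EFinP/measurable_indic.
- by move=> y x _; rewrite mule_ge0 ?lee_fin//; exact: nnfun_muleindic_ge0.
apply: eq_integral => x _.
rewrite -ge0_mule_fsuml; last by move=> y; exact: nnfun_muleindic_ge0.
by rewrite [in RHS]fimfunE -fsumEFin.
Qed.

Lemma ge0_integral_density (f : T -> \bar R) :
  measurable_fun setT f -> (forall x, 0 <= f x) ->
  \int[nu]_x f x = \int[mu]_x (f x * (w x)%:E).
Proof.
move=> mf f0; pose g := nnsfun_approx measurableT mf.
have gf x : (g k x)%:E @[k --> \oo] --> f x.
  by apply: cvg_nnsfun_approx => // y _; exact: f0.
transitivity (limn (fun k => \int[nu]_x (g k x)%:E)).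
  rewrite -monotone_convergence//.
  - by apply: eq_integral => x _; apply/esym/cvg_lim.
  - by move=> k; apply/measurable_EFinP.
  - by move=> k x _; rewrite lee_fin.
  - by move=> x _ a b ab; rewrite lee_fin; exact/lefP/nd_nnsfun_approx.
transitivity (limn (fun k => \int[mu]_x ((g k x)%:E * (w x)%:E))).
  by congr (limn _); apply/funext => k; exact: integral_density_nnsfun.
rewrite -monotone_convergence//.
- apply: eq_integral => x _; apply/cvg_lim => //.
  exact: cvgeZr.
- by move=> k; apply: emeasurable_funM; exact/measurable_EFinP.
- by move=> k x _; rewrite mule_ge0// lee_fin.
- move=> x _ a b ab; apply: lee_wpmul2r; rewrite lee_fin//.
  exact/lefP/nd_nnsfun_approx.
Qed.

End integral_of_density.

Section polar_coordinates.
Context {R : realType} {n : nat}.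
Hypothesis n_gt0 : (0 < n)%N.
Local Notation mu := (leb n).
Local Open Scope ereal_scope.

Let vol1 : R := fine (leb n (@eball R n 1)).

Let vol1E : vol1%:E = leb n (@eball R n 1).
Proof. by rewrite fineK// ge0_fin_numE// leb_eball_lty. Qed.

Let vol1_ge0 : (0 <= vol1)%R.
Proof. by rewrite fine_ge0. Qed.

(** The area of the sphere of radius r, extended by 0 to r <= 0. *)
Definition sphere_area (r : R) : R :=
  (n%:R * vol1 * r ^+ n.-1 * \1_(`]0%R, +oo[%classic) r)%R.

Lemma sphere_areaE (r : R) : (0 < r)%R ->
  (sphere_area r)%:E = (n%:R / r)%:E * leb n (@eball R n r).
Proof.
move=> r0; rewrite /sphere_area indicE mem_set/= ?in_itv/= ?r0// mulr1.
rewrite leb_eball// -vol1E -!EFinM; congr EFin.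
have -> : (r ^+ n = r * r ^+ n.-1)%R by rewrite -exprS prednK.
by field; rewrite gt_eqF.
Qed.

Lemma sphere_area_ge0 (r : R) : (0 <= sphere_area r)%R.
Proof.
rewrite /sphere_area indicE.
have [/set_mem/=|_] := boolP (_ \in _); last by rewrite mulr0.
by rewrite in_itv/= andbT mulr1 => r0; rewrite mulr_ge0 ?mulr_ge0// exprn_ge0// ltW.
Qed.

Lemma measurable_sphere_area : measurable_fun setT sphere_area.
Proof.
apply: measurable_funM; last by apply: measurable_indic.
by apply: measurable_funM => //; exact: exprn_measurable.
Qed.

Let sphere_measure (A : set (measurableTypeR R)) : \bar R :=
  \int[lebesgue_measure]_(r in A) (sphere_area r)%:E.

Let sphere_measure0 : sphere_measure set0 = 0.
Proof. by rewrite /sphere_measure integral_set0. Qed.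

Let sphere_measure_ge0 A : 0 <= sphere_measure A.
Proof. by apply: integral_ge0 => x _; rewrite lee_fin sphere_area_ge0. Qed.

Let sphere_measure_additive : semi_sigma_additive sphere_measure.
Proof.
apply: (@semi_sigma_additive_nng_induced _ _ _ lebesgue_measure (EFin \o sphere_area)).
  by apply/measurable_EFinP; exact: measurable_sphere_area.
by move=> x; rewrite /= lee_fin sphere_area_ge0.
Qed.

HB.instance Definition _ := isMeasure.Build _ _ _ sphere_measure
  sphere_measure0 sphere_measure_ge0 sphere_measure_additive.

(** The area of spheres is the derivative of the volume of balls. *)
Let sphere_measure_ray (b : R) : sphere_measure `]-oo, b[ =
  if (0 < b)%R then (b ^+ n)%:E * leb n (@eball R n 1) else 0.
Proof.
case: ifPn => [b0|b0]; last first.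
  apply: integral0_eq => r /=; rewrite in_itv/= => rb; congr EFin.
  rewrite /sphere_area indicE memNset ?mulr0//= in_itv/= andbT => r0.
  by move: b0; rewrite (lt_trans r0 rb).
pose f (r : R) := (n%:R * vol1 * r ^+ n.-1)%R.
pose F (r : R) := (vol1 * r ^+ n)%R.
have cX k (c : R) : continuous (fun r : R => c * r ^+ k)%R.
  by move=> r; apply: cvgM; [exact: cvg_cst|exact: exprn_continuous].
have mf (D : set (measurableTypeR R)) : measurable_fun D (EFin \o f).
  apply/measurable_EFinP; apply: measurable_funM => //; exact: exprn_measurable.
transitivity (\int[lebesgue_measure]_(r in `]0%R, b[) (f r)%:E).
  rewrite /sphere_measure [LHS]integral_mkcond [RHS]integral_mkcond.
  apply: eq_integral => r _; rewrite !patchE /sphere_area indicE !mem_setE !in_itv/=.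
  by case: ltP => // r0; case: ltP => // rb; rewrite /= ?mulr1 ?mulr0.
rewrite integral_itv_bndo_bndc; last exact: mf.
rewrite (@integral_itv_obnd_cbnd R); last exact: mf.
rewrite (continuous_FTC2 (F := F))//.
- by rewrite /F expr0n gtn_eqF//= mulr0 sube0 -vol1E -EFinM mulrC.
- by apply: continuous_subspaceT; exact: cX.
- split.
  + by move=> x _; apply: derivableM => //; exact: exprn_derivable.
  + by apply: cvg_at_right_filter; exact: cX.
  + by apply: cvg_at_left_filter; exact: cX.
- move=> x _; rewrite derive1E.
  rewrite (_ : F = vol1 \*o (@GRing.exp R ^~ n)) ?deriveMl//; last first.
    exact: exprn_derivable.
  by rewrite exp_derive /f /GRing.scale/= mulr1 mulrA (mulrC vol1).
Qed.

Let leb_enorm_ray (b : R) : leb n (@enorm R n @^-1` `]-oo, b[) =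
  if (0 < b)%R then (b ^+ n)%:E * leb n (@eball R n 1) else 0.
Proof.
rewrite (_ : _ @^-1` _ = eball b); last by apply/seteqP; split => x /=; rewrite in_itv.
case: ifPn => [|b0]; first exact: leb_eball.
rewrite (_ : eball b = set0) ?measure0//.
apply/seteqP; split => // x /= xb.
by apply: (negP b0); exact: le_lt_trans (enorm_ge0 _) xb.
Qed.

Let leb_enorm (A : set (measurableTypeR R)) : measurable A ->
  leb n (@enorm R n @^-1` A) = sphere_measure A.
Proof.
move=> mA; have me : measurable_fun setT (@enorm R n : _ -> measurableTypeR R).
  exact: measurable_enorm.
pose nu1 := image_measure (leb n) me.
rewrite -[LHS]/(nu1 A).
refine (@measure_unique _ R (measurableTypeR R) (@RGenInftyO.G R)
  (fun k => `]-oo, k%:R[%classic) _ _ _ _ nu1 sphere_measure _ _ A mA).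
- exact: RGenInftyO.measurableE.
- move=> _ _ [x ->] [y ->]; exists (Num.min x y).
  by apply/seteqP; split => z /=; rewrite !in_itv/= lt_min => /andP.
- by move=> k; exists k%:R%R.
- apply/seteqP; split => // x _; exists (Num.trunc x).+1 => //=.
  by rewrite in_itv/=; exact: truncnS_gt.
- move=> _ [b ->]; exact: etrans (leb_enorm_ray _) (esym (sphere_measure_ray _)).
- move=> k; rewrite -[X in X < _]/(leb n (@enorm R n @^-1` `]-oo, k%:R[)).
  rewrite leb_enorm_ray; case: ifP => _; last exact: ltry.
  by rewrite -vol1E -EFinM ltry.
Qed.

(** The law of the norm under Lebesgue measure has density [sphere_area]: both
    give the volume of the ball of radius b to the ray below b, and rays
    determine a measure. *)
Lemma integral_radial (f : R -> \bar R) :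
  measurable_fun setT f -> (forall r, 0 <= f r) ->
  \int[leb n]_x f (enorm x) = \int[lebesgue_measure]_r (f r * (sphere_area r)%:E).
Proof.
move=> mf f0.
rewrite -(ge0_integral_density (nu := sphere_measure) measurable_sphere_area)//;
  last exact: sphere_area_ge0.
have me : measurable_fun setT (@enorm R n : _ -> measurableTypeR R).
  exact: measurable_enorm.
pose nu1 := image_measure (leb n) me.
transitivity (\int[nu1]_r f r).
  by rewrite (ge0_integral_pushforward me).
apply: (@eq_measure_integral _ (measurableTypeR R) R setT sphere_measure nu1).
by move=> A mA _; exact: leb_enorm.
Qed.

End polar_coordinates.

(** * The kernel mu_rho *)

Section mass_of_mu_rho.
Context {R : realType} {n : nat}.
Hypothesis n_gt0 : (0 < n)%N.
Variable phi : R -> R.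
Hypotheses (mphi : measurable_fun setT phi) (phi_ge0 : forall r, 0 <= phi r).
Local Open Scope ereal_scope.
Local Notation leb1 := (@lebesgue_measure R).

Let below := [set z : 'rV[R]_n * measurableTypeR R | (enorm z.1 < z.2)%R].

Let belowE (x : 'rV[R]_n) (r : R) : \1_below (x, r) = \1_(eball r) x :> R.
Proof.
by rewrite !indicE; congr (nat_of_bool _)%:R%R.
Qed.

(** The integrand of mu_rho. The inverse of the radius is written as a power,
    which is measurable on the whole line; the set [below] only contains points
    with positive radius, so the restriction of the integral to r > 0 is
    implied. *)
Let K (z : 'rV[R]_n * measurableTypeR R) : \bar R :=
  (n%:R * phi z.2 * z.2 `^ (-1) *
    \1_below z)%:E.

Let mbelow : measurable below.
Proof.
rewrite -[X in measurable X]setTI.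
rewrite (_ : below = (fun z : 'rV[R]_n * measurableTypeR R =>
  (enorm z.1 < z.2)%R) @^-1` [set true]); last by apply/seteqP; split.
have : measurable_fun setT
    (fun z : 'rV[R]_n * measurableTypeR R => (enorm z.1 < z.2)%R).
  apply: measurable_fun_ltr => //.
  by apply: (measurableT_comp (@measurable_enorm R n)).
by apply.
Qed.

Let mK : measurable_fun setT K.
Proof.
apply/measurable_EFinP; apply: measurable_funM; last exact: measurable_indic.
apply: measurable_funM; last first.
  apply: (measurableT_comp (f := fun r : R => r `^ (-1))%R).
    exact: measurable_powR.
  exact: measurable_snd.
apply: measurable_funM => //.
exact: (measurableT_comp mphi).
Qed.

Let K_ge0 z : 0 <= K z.
Proof.
rewrite lee_fin indicE.
have [_|_] := boolP (z \in _); last by rewrite mulr0.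
by rewrite mulr1 mulr_ge0 ?mulr_ge0// powR_ge0.
Qed.

(** The integral in the extended reals, where [mu_rho] has 0 instead of +oo. *)
Let M (x : 'rV[R]_n) : \bar R := \int[leb1]_r K (x, r).

Let mM : measurable_fun setT M.
Proof. exact: (measurable_fun_fubini_tonelli_F K). Qed.

Let M_ge0 x : 0 <= M x.
Proof. exact: integral_ge0. Qed.

Let mu_rhoE x : mu_rho phi x = fine (M x).
Proof.
rewrite /mu_rho /Rintegral integral_mkcond; congr fine.
apply: eq_integral => r _; rewrite patchE /K belowE /= mem_setE in_itv/= andbT.
case: ifPn => r0; first by rewrite powR_inv1 ?ltW// mulrAC.
rewrite indicE memNset ?mulr0//= => xr; move: r0; rewrite (le_lt_trans _ xr)//.
exact: enorm_ge0.
Qed.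

Let integral_K (A : set 'rV[R]_n) (r : R) : measurable A ->
  \int[leb n]_(x in A) K (x, r) =
  (n%:R * phi r / r)%:E * leb n (A `&` eball r).
Proof.
move=> mA; have [r0|r0] := leP r 0%R.
  rewrite (_ : A `&` eball r = set0); last first.
    apply/seteqP; split => // x [_] /= xr.
    by have := lt_le_trans xr r0; rewrite ltNge enorm_ge0.
  rewrite measure0 mule0; apply: integral0_eq => x _.
  rewrite /K belowE indicE memNset; first by rewrite mulr0.
  by move=> xr; have := lt_le_trans xr r0; rewrite ltNge enorm_ge0.
rewrite (eq_integral (fun x => (n%:R * phi r / r)%:E * (\1_(eball r) x)%:E));
  last first.
  by move=> x _; rewrite /K belowE/= -EFinM powR_inv1 ?ltW.
rewrite ge0_integralZl//; first last.
- by rewrite lee_fin mulr_ge0 ?mulr_ge0// invr_ge0 ltW.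
- apply: measurable_funTS; apply/measurable_EFinP; apply: measurable_indic.
  exact: measurable_eball.
- by rewrite integral_indic// 1?setIC//; exact: measurable_eball.
Qed.

Let KA (A : set 'rV[R]_n) z : \bar R := (\1_A z.1)%:E * K z.

Let mKA A : measurable A -> measurable_fun setT (KA A).
Proof.
move=> mA; apply: emeasurable_funM => //; apply/measurable_EFinP.
exact: (measurableT_comp (measurable_indic mA)).
Qed.

Let KA_ge0 A z : 0 <= KA A z.
Proof. by rewrite mule_ge0// lee_fin. Qed.

Let integral_KA A r : \int[leb n]_x KA A (x, r) = \int[leb n]_(x in A) K (x, r).
Proof.
by rewrite [RHS]integral_mkcond; apply: eq_integral => x _; rewrite epatch_indic muleC.
Qed.

Let measurable_integral_K A : measurable A ->
  measurable_fun setT (fun r : measurableTypeR R => \int[leb n]_(x in A) K (x, r)).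
Proof.
move=> mA; under eq_fun do rewrite -integral_KA.
exact: (measurable_fun_fubini_tonelli_G (KA A) (mKA mA) (KA_ge0 A)).
Qed.

Let integral_M_swap (A : set 'rV[R]_n) : measurable A ->
  \int[leb n]_(x in A) M x = \int[leb1]_r \int[leb n]_(x in A) K (x, r).
Proof.
move=> mA; rewrite integral_mkcond; under [RHS]eq_integral do rewrite -integral_KA.
rewrite -(fubini_tonelli (m1 := leb n) (m2 := leb1) (KA A) (mKA mA) (KA_ge0 A)).
apply: eq_integral => x _; rewrite patchE /KA/= indicE.
case: (x \in A); first by under [RHS]eq_integral do rewrite mul1e.
by under [RHS]eq_integral do rewrite mul0e; rewrite integral0.
Qed.

Let integral_M : \int[leb n]_x M x = \int[leb n]_x (phi (enorm x))%:E.
Proof.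
have mE : measurable_fun setT (EFin \o phi) by exact/measurable_EFinP.
rewrite (integral_radial n_gt0 mE); last by move=> r; rewrite /= lee_fin.
rewrite integral_M_swap//; apply: eq_integral => r _; rewrite integral_K// setTI.
have [r0|r0] := leP r 0%R.
  rewrite /sphere_area indicE memNset ?mulr0 ?mule0; last first.
    by rewrite /= in_itv/= andbT; apply/negP; rewrite -leNgt.
  rewrite (_ : eball r = set0) ?measure0 ?mule0//.
  apply/seteqP; split => // x /= xr.
  by have := lt_le_trans xr r0; rewrite ltNge enorm_ge0.
rewrite sphere_areaE// muleA -EFinM; congr (_%:E * _).
by rewrite mulrA (mulrC (phi r)).
Qed.

(** For r <= delta the ball of radius r does not meet the complement of B_delta;
    for r > delta its part outside B_delta has at most the measure of the ball,
    which is the contribution of r to the integral of rho outside B_delta. *)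
Let integral_M_tail (delta : R) :
  \int[leb n]_(x in ~` eball delta) M x <=
  \int[leb n]_(x in ~` eball delta) (phi (enorm x))%:E.
Proof.
have mC : measurable (~` @eball R n delta).
  by apply: measurableC; exact: measurable_eball.
pose f r := (phi r * \1_(`[delta, +oo[%classic) r)%R.
have mf : measurable_fun setT f.
  by apply: measurable_funM => //; exact: measurable_indic.
have f0 r : (0 <= f r)%R by rewrite mulr_ge0.
rewrite [leRHS](_ : _ = \int[leb n]_x (f (enorm x))%:E); last first.
  rewrite integral_mkcond; apply: eq_integral => x _.
  rewrite epatch_indic -EFinM /f !indicE; congr (_ * (nat_of_bool _)%:R)%:E.
  by apply/idP/idP => /set_mem h; apply/mem_set; move: h;
    rewrite /eball/= in_itv/= andbT leNgt => /negP.
have mE : measurable_fun setT (EFin \o f) by exact/measurable_EFinP.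
rewrite (integral_radial n_gt0 mE); last by move=> r; rewrite /= lee_fin.
rewrite integral_M_swap//; apply: ge0_le_integral => //.
- by move=> r _; apply: integral_ge0.
- exact: measurable_integral_K.
- apply: emeasurable_funM; first exact/measurable_EFinP.
  by apply/measurable_EFinP; exact: measurable_sphere_area.
move=> r _; rewrite integral_K//.
have [r0|r0] := leP r 0%R.
  rewrite (_ : _ `&` _ = set0); last first.
    apply/seteqP; split => // x [_] /= xr.
    by have := lt_le_trans xr r0; rewrite ltNge enorm_ge0.
  by rewrite measure0 mule0 mule_ge0// lee_fin// sphere_area_ge0.
have [rd|dr] := ltP r delta.
  rewrite (_ : _ `&` _ = set0); last first.
    apply/seteqP; split => // x [] /= xd xr; apply: xd.
    exact: lt_trans xr rd.
  by rewrite measure0 mule0 mule_ge0// lee_fin// sphere_area_ge0.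
rewrite sphere_areaE//= /f indicE mem_set ?mulr1/=; last by rewrite in_itv/= dr.
rewrite muleA -EFinM mulrA (mulrC n%:R (phi r)).
apply: lee_wpmul2l.
  by rewrite lee_fin mulr_ge0 ?mulr_ge0// invr_ge0 ltW.
apply: le_measure; rewrite ?inE; [|exact: measurable_eball|by apply: subIsetr].
by apply: measurableI => //; exact: measurable_eball.
Qed.

Hypothesis phi_mass : \int[leb n]_x (phi (enorm x))%:E = 1.

Lemma measurable_mu_rho : measurable_fun setT (@mu_rho R n phi).
Proof.
rewrite (_ : mu_rho phi = fine \o M); last by apply/funext => x; exact: mu_rhoE.
exact: measurableT_comp.
Qed.

Lemma mu_rho_ge0 x : (0 <= @mu_rho R n phi x)%R.
Proof. by rewrite mu_rhoE fine_ge0. Qed.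

Lemma mu_rhoN x : mu_rho phi (- x)%R = @mu_rho R n phi x.
Proof.
rewrite !mu_rhoE; congr fine; apply: eq_integral => r _.
rewrite /K !belowE; congr (_ * _)%:E.
by rewrite !indicE; congr (nat_of_bool _)%:R%R; apply/idP/idP => /set_mem;
  rewrite /eball/= ?enormN => h; apply/mem_set; rewrite /= ?enormN.
Qed.

(** The function M has finite integral, hence is finite almost everywhere, so
    that replacing the value +oo by 0 does not change the integral. *)
Lemma integral_mu_rho : \int[leb n]_x (@mu_rho R n phi x)%:E = 1.
Proof.
rewrite -phi_mass -integral_M; apply: ge0_ae_eq_integral => //.
- by apply/measurable_EFinP; exact: measurable_mu_rho.
- by move=> x _; rewrite lee_fin mu_rho_ge0.
have Mi : (leb n).-integrable setT M.
  apply/integrableP; split => //.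
  under eq_integral do rewrite gee0_abs//.
  by rewrite integral_M phi_mass ltry.
have := integrable_ae measurableT Mi; apply: filterS => x /(_ I) Mx _.
by rewrite mu_rhoE fineK.
Qed.

Lemma integral_mu_rho_tail (delta : R) :
  \int[leb n]_(x in ~` eball delta) (@mu_rho R n phi x)%:E <=
  \int[leb n]_(x in ~` eball delta) (phi (enorm x))%:E.
Proof.
apply: le_trans (integral_M_tail delta).
apply: ge0_le_integral => //.
- by apply: measurableC; exact: measurable_eball.
- by move=> x _; rewrite lee_fin mu_rho_ge0.
- by apply: measurable_funTS; apply/measurable_EFinP; exact: measurable_mu_rho.
- exact: measurable_funTS.
move=> x _; rewrite mu_rhoE; have [->//|Mx] := eqVneq (M x) +oo; first by rewrite leey.
by rewrite fineK// ge0_fin_numE// ltey.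
Qed.

End mass_of_mu_rho.

(** * Coordinates in an inner product space *)

Section inner_product_coordinates.
Context {R : realType} {W : vectType R}.
Variable ip : {dot W for @idfun R}.
Local Notation b := (vbasis {:W}).

Lemma ip_coord u v : ip u v =
  \sum_(i < \dim {:W}) \sum_(j < \dim {:W}) coord b i u * coord b j v * ip b`_i b`_j.
Proof.
rewrite {1}(coord_vbasis (memvf u)) linear_sumlz/=; apply: eq_bigr => i _.
rewrite {1}(coord_vbasis (memvf v)) linear_sumr/=; apply: eq_bigr => j _.
by rewrite linearZl_LR/= linearZr_LR/= mulrA.
Qed.

Lemma vnorm_ge0 v : 0 <= vnorm ip v.
Proof. exact: sqrtr_ge0. Qed.

Lemma dot_ge0 (v : W) : 0 <= ip v v.
Proof.
by have [->|v0] := eqVneq v 0; [rewrite linear0r|exact/ltW/neq0_dnorm_gt0].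
Qed.

Lemma dotC (u v : W) : ip u v = ip v u.
Proof. by rewrite hermC/= expr0 mul1r. Qed.

Lemma dotZl a (u v : W) : ip (a *: u) v = a * ip u v.
Proof. exact: linearZl_LR. Qed.

Lemma dotZr a (u v : W) : ip u (a *: v) = a * ip u v.
Proof. by rewrite dotC dotZl dotC. Qed.

(** Cauchy-Schwarz, from the nonnegativity of the square of <v,v> u - <u,v> v. *)
Lemma dot_le_vnorm u v : `|ip u v| <= vnorm ip u * vnorm ip v.
Proof.
have [->|v0] := eqVneq v 0; first by rewrite linear0r normr0 mulr_ge0 ?vnorm_ge0.
have vv := neq0_dnorm_gt0 (s := ip) v v0.
rewrite /vnorm -sqrtrM ?dot_ge0// -sqrtr_sqr ler_wsqrtr// -subr_ge0.
have := dot_ge0 (ip v v *: u - ip u v *: v).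
rewrite linearBl !linearBr/= !dotZl !dotZr (dotC v u).
set a := ip u u; set c := ip v v in vv *; set d := ip u v.
rewrite (_ : _ - _ = c * (a * c - d ^+ 2)); last by ring.
by rewrite pmulr_rge0.
Qed.

(** By Cauchy-Schwarz it suffices to write the j-th coordinate as an inner
    product with a fixed vector. The adjoint of the endomorphism
    v |-> coord j v *: b_j, applied to b_j, is such a vector up to the factor
    <b_j,b_j>. *)
Lemma coord_le_vnorm : exists2 C : R, 0 <= C &
  forall j v, `|coord b j v| <= C * vnorm ip v.
Proof.
have /choice[C CP] : forall j : 'I_(\dim {:W}), exists C : R, 0 <= C /\
    forall v, `|coord b j v| <= C * vnorm ip v.
  move=> j.
  pose h (v : W) := coord b j v *: b`_j.
  have hl : linear h by move=> a x y; rewrite /h linearP scalerDl scalerA.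
  pose hL := GRing.isLinear.Build _ _ _ _ h hl.
  pose H : {linear W -> W} := HB.pack h hL.
  have bj0 : 0 < ip b`_j b`_j.
    apply: neq0_dnorm_gt0; apply: (basis_not0 (vbasisP {:W})).
    by rewrite mem_nth// size_tuple.
  exists ((ip b`_j b`_j)^-1 * vnorm ip (adjoint ip ip (linfun H) b`_j)); split.
    by rewrite mulr_ge0 ?vnorm_ge0// invr_ge0 ltW.
  move=> v; have := adjointP ip ip (linfun H) v b`_j.
  rewrite lfunE /= /h dotZl => hE.
  have -> : coord b j v = (ip b`_j b`_j)^-1 * ip v (adjoint ip ip (linfun H) b`_j).
    by rewrite -hE mulrC mulfK// gt_eqF.
  rewrite normrM gtr0_norm ?invr_gt0// -mulrA.
  apply: ler_wpM2l; first by rewrite invr_ge0 ltW.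
  by rewrite [leRHS]mulrC dot_le_vnorm.
exists (\sum_j C j).
  by apply: sumr_ge0 => j _; have [] := CP j.
move=> j v; apply: (le_trans ((CP j).2 v)); rewrite ler_wpM2r ?vnorm_ge0//.
by rewrite (bigD1 j)//= lerDl sumr_ge0// => i _; have [] := CP i.
Qed.

Lemma vnorm_le_coord : exists2 C : R, 0 <= C &
  forall v, vnorm ip v <= C * \sum_j `|coord b j v|.
Proof.
pose B := \sum_(i < \dim {:W}) \sum_(j < \dim {:W}) `|ip b`_i b`_j|.
have B0 : 0 <= B by apply: sumr_ge0 => i _; exact: sumr_ge0.
exists (Num.sqrt B); first exact: sqrtr_ge0.
move=> v; set S := \sum_j _.
have S0 : 0 <= S by exact: sumr_ge0.
rewrite -[S]ger0_norm// -sqrtr_sqr -sqrtrM// ler_wsqrtr// ip_coord.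
have cS i : `|coord b i v| <= S by rewrite /S (bigD1 i)//= lerDl sumr_ge0.
rewrite mulr_suml; apply: ler_sum => i _; rewrite mulr_suml; apply: ler_sum => j _.
apply: (le_trans (ler_norm _)); rewrite !normrM mulrC ler_wpM2l//.
by rewrite expr2 ler_pM.
Qed.

End inner_product_coordinates.

(** * Convolution of an integrable function with a probability density *)

Section mollification.
Context {R : realType} {n : nat}.
Variables (m g : 'rV[R]_n -> R).
Hypotheses (mm : measurable_fun setT m) (m_ge0 : forall x, 0 <= m x).
Hypothesis (m_mass : (\int[leb n]_x (m x)%:E = 1)%E).
Hypothesis ig : (leb n).-integrable setT (EFin \o g).
Local Open Scope ereal_scope.
Local Notation mu := (leb n).

Let mg : measurable_fun setT g.
Proof. by apply/measurable_EFinP; exact: measurable_int ig. Qed.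

Lemma measurable_kernel_sub : measurable_fun setT
  (fun z : 'rV[R]_n * 'rV[R]_n => m (z.1 - z.2)%R).
Proof. by apply: (measurableT_comp mm); exact: measurable_subr_rV. Qed.

Let mg1 : measurable_fun setT (fun z : 'rV[R]_n * 'rV[R]_n => g z.1).
Proof. exact: (measurableT_comp mg). Qed.

Let mg2 : measurable_fun setT (fun z : 'rV[R]_n * 'rV[R]_n => g z.2).
Proof. exact: (measurableT_comp mg). Qed.

Lemma integral_kernel_l (y : 'rV[R]_n) : \int[mu]_x (m (x - y)%R)%:E = 1.
Proof.
rewrite -m_mass (ge0_integral_shift (- y) (f := EFin \o m))//.
exact/measurable_EFinP.
Qed.

Lemma integral_kernel_r (x : 'rV[R]_n) : \int[mu]_y (m (x - y)%R)%:E = 1.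
Proof.
have mmN : measurable_fun setT (fun y : 'rV[R]_n => (m (- y)%R)%:E).
  by apply/measurable_EFinP/(measurableT_comp mm); exact: measurable_opp_rV.
have mmE : measurable_fun setT (EFin \o m) by exact/measurable_EFinP.
have m0 (y : 'rV[R]_n) : 0 <= (m y)%:E by rewrite lee_fin.
have mN0 (y : 'rV[R]_n) : 0 <= (m (- y)%R)%:E by rewrite lee_fin.
rewrite -m_mass -(ge0_integral_opp mmE m0) -(ge0_integral_shift (- x) mmN mN0).
by apply: eq_integral => y _; rewrite opprD opprK addrC.
Qed.

Lemma measurable_kernel_at (x : 'rV[R]_n) :
  measurable_fun setT (fun y : 'rV[R]_n => m (x - y)%R).
Proof.
apply: (measurableT_comp mm).
rewrite (_ : (fun y => x - y)%R = (fun z => z + x)%R \o (fun y : 'rV[R]_n => - y)%R).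
  by apply: measurableT_comp; [exact: measurable_shift|exact: measurable_opp_rV].
by apply/funext => y /=; rewrite addrC.
Qed.

Lemma integrable_kernel_at (x : 'rV[R]_n) :
  mu.-integrable setT (fun y => (m (x - y)%R)%:E).
Proof.
apply/integrableP; split.
  by apply/measurable_EFinP; exact: measurable_kernel_at.
under eq_integral do rewrite gee0_abs ?lee_fin//.
by rewrite integral_kernel_r ltry.
Qed.

Lemma integrable_kernel_r (x : 'rV[R]_n) (psi : 'rV[R]_n -> R) (C : R) :
  measurable_fun setT psi -> (forall y, `|psi y| <= C)%R ->
  mu.-integrable setT (fun y => (m (x - y)%R * psi y)%:E).
Proof.
move=> mpsi psiC; have mmx := measurable_kernel_at x.
apply: (@le_integrable _ _ _ mu setT measurableT _ (fun y => (m (x - y)%R * C)%:E)).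
- by apply/measurable_EFinP; exact: measurable_funM.
- move=> y _; rewrite !abse_EFin lee_fin !normrM ler_wpM2l//.
  exact: le_trans (psiC y) (ler_norm _).
- under eq_fun do rewrite EFinM muleC.
  by apply: integrableZl => //; exact: integrable_kernel_at.
Qed.

Let K (z : 'rV[R]_n * 'rV[R]_n) : \bar R := (m (z.1 - z.2)%R * g z.2)%:E.

Let mK : measurable_fun setT K.
Proof.
by apply/measurable_EFinP; apply: measurable_funM => //; exact: measurable_kernel_sub.
Qed.

Let iK : (leb n \x leb n).-integrable setT K.
Proof.
apply: (integrable21ltyP (leb n) (leb n) mK).2.
rewrite (eq_integral (fun y => `|(g y)%:E|)); last first.
  move=> y _; under eq_integral do rewrite /K/= normrM (ger0_norm (m_ge0 _)) mulrC EFinM.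
  rewrite ge0_integralZl//; first by rewrite integral_kernel_l mule1.
    by apply/measurable_EFinP/(measurableT_comp mm); exact: measurable_shift.
  by move=> x _; rewrite lee_fin.
have /integrableP[_ H] := ig. exact: H.
Qed.

Definition mollify (x : 'rV[R]_n) : R := fine (\int[mu]_y (m (x - y)%R * g y)%:E).

Let F := fubini_F (leb n) K.

Let mollifyE x : mollify x = fine (F x).
Proof. by []. Qed.

Lemma measurable_mollify : measurable_fun setT mollify.
Proof.
rewrite (_ : mollify = fine \o F)//; apply: measurableT_comp => //.
exact: measurable_fubini_F iK.
Qed.

Let F_fin : {ae mu, forall x, F x = (mollify x)%:E}.
Proof.
have := integrable_ae measurableT (integrable_fubini_F iK).
by apply: filterS => x /(_ I) Fx; rewrite mollifyE fineK.
Qed.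

Lemma integrable_mollify : mu.-integrable setT (EFin \o mollify).
Proof.
apply: (@le_integrable _ _ _ mu setT measurableT _ F).
- by apply/measurable_EFinP; exact: measurable_mollify.
- by move=> x _; rewrite /= mollifyE; case: (F x) => //= *; rewrite ?normr0 ?leey.
- exact: integrable_fubini_F.
Qed.

Section duality.
Hypothesis m_even : forall x, m (- x)%R = m x.
Variables (psi : 'rV[R]_n -> R) (C : R).
Hypotheses (mpsi : measurable_fun setT psi) (psiC : forall y, (`|psi y| <= C)%R).

Let L (z : 'rV[R]_n * 'rV[R]_n) : \bar R := (g z.1 * (m (z.1 - z.2)%R * psi z.2))%:E.

Let mL : measurable_fun setT L.
Proof.
apply/measurable_EFinP; apply: measurable_funM => //.
apply: measurable_funM; first exact: measurable_kernel_sub.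
exact: (measurableT_comp mpsi).
Qed.

Let iL : (leb n \x leb n).-integrable setT L.
Proof.
apply: (integrable12ltyP (leb n) (leb n) mL).2.
have C0 : (0 <= C)%R by apply: le_trans (psiC 0%R).
have mgC : measurable_fun setT (fun x => (C * `|g x|)%R%:E).
  apply/measurable_EFinP; apply: measurable_funM => //.
  exact: (measurableT_comp (@normr_measurable R setT)).
apply: (@le_lt_trans _ _ (\int[mu]_x (C * `|g x|)%:E)); last first.
  have /integrableP[_] : mu.-integrable setT (fun x => C%:E * (g x)%:E).
    exact: integrableZl.
  congr (_ < _); apply: eq_integral => x _.
  by rewrite -EFinM abse_EFin normrM ger0_norm.
have mabsL : measurable_fun setT (abse \o L) by exact: measurableT_comp.
apply: ge0_le_integral => //.
- by move=> x _; exact: integral_ge0.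
- exact: (measurable_fun_fubini_tonelli_F (abse \o L) mabsL (fun z => abse_ge0 _)).
move=> x _.
have mmx : measurable_fun setT (fun y : 'rV[R]_n => (m (x - y)%R)%:E).
  by apply/measurable_EFinP; exact: measurable_kernel_at.
have -> : (C * `|g x|)%:E = \int[mu]_y ((C * `|g x|)%:E * (m (x - y)%R)%:E).
  rewrite ge0_integralZl//; first by rewrite integral_kernel_r mule1.
    by move=> y _; rewrite lee_fin.
  by rewrite lee_fin mulr_ge0.
apply: ge0_le_integral => //.
- apply: (measurableT_comp mabsL); exact: pair1_measurable.
- exact: measurable_funeM.
move=> y _; rewrite /L/= -EFinM lee_fin !normrM (ger0_norm (m_ge0 _)).
rewrite [leRHS](_ : _ = `|g x| * (m (x - y) * C))%R; last by ring.
by apply: ler_wpM2l => //; exact: ler_wpM2l.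
Qed.

Let test_kernelE : (fun x => (g x * fine (\int[mu]_y (m (x - y)%R * psi y)%:E))%:E) =
  fubini_F (leb n) L.
Proof.
apply/funext => x; rewrite EFinM fineK; last first.
  exact: (integrable_fin_num measurableT (integrable_kernel_r x mpsi psiC)).
by rewrite -integralZl//; exact: integrable_kernel_r mpsi psiC.
Qed.

Lemma integrable_test_mollified :
  mu.-integrable setT (fun x => (g x * fine (\int[mu]_y (m (x - y)%R * psi y)%:E))%:E).
Proof. by rewrite test_kernelE; exact: integrable_fubini_F iL. Qed.

Lemma integrable_mollify_test : mu.-integrable setT (fun x => (mollify x * psi x)%:E).
Proof.
have : mu.-integrable setT (fun x => C%:E * (mollify x)%:E).
  by apply: integrableZl => //; exact: integrable_mollify.
apply: le_integrable => //.
  apply/measurable_EFinP; apply: measurable_funM => //; exact: measurable_mollify.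
move=> x _; rewrite -EFinM !abse_EFin lee_fin !normrM mulrC ler_wpM2r//.
exact: le_trans (psiC x) (ler_norm _).
Qed.

(** Fubini for (x, y) |-> g x * m (x - y) * psi y; integrating first in x gives the
    convolution of g because m is even. *)
Lemma mollify_duality :
  \int[mu]_x (g x * fine (\int[mu]_y (m (x - y)%R * psi y)%:E))%:E =
  \int[mu]_x (mollify x * psi x)%:E.
Proof.
rewrite test_kernelE -[LHS]/(\int[mu]_x \int[mu]_y L (x, y)) (Fubini iL).
apply: ae_eq_integral => //.
- exact: measurable_fubini_G iL.
- apply/measurable_EFinP; apply: measurable_funM => //; exact: measurable_mollify.
have := ae_integrable1 iK; apply: filterS2 F_fin => y Fy iKy _.
rewrite EFinM -Fy muleC /F /fubini_F -integralZl//.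
apply: eq_integral => x _; rewrite /L /K -EFinM; congr EFin => /=.
by rewrite -m_even opprB; ring.
Qed.

End duality.

(** Since m has integral 1, for almost every x the difference mollify x - g x is
    the integral in y of m (x - y) * (g y - g x). Taking absolute values,
    integrating in x first and putting h = x - y leaves the L1 distance between g
    and its translate. *)
Lemma mollify_dist_le :
  \int[mu]_x (`|mollify x - g x|%R)%:E <= \int[mu]_h ((m h)%:E * shift_dist g h).
Proof.
pose D (z : 'rV[R]_n * 'rV[R]_n) : \bar R := (m (z.1 - z.2)%R * `|g z.2 - g z.1|)%:E.
have mD : measurable_fun setT D.
  apply/measurable_EFinP; apply: measurable_funM; first exact: measurable_kernel_sub.
  by apply: measurableT_comp => //; exact: measurable_funB.
have D0 z : 0 <= D z by rewrite lee_fin mulr_ge0.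
apply: (@le_trans _ _ (\int[mu]_x \int[mu]_y D (x, y))).
  apply: ae_ge0_le_integral => //.
  - by apply: measurable_dist => //; exact: measurable_mollify.
  - by move=> x _; exact: integral_ge0.
  - exact: (measurable_fun_fubini_tonelli_F D mD D0).
  have := ae_integrable1 iK; apply: filterS2 F_fin => x Fx iKx _.
  have igx : mu.-integrable setT (fun y => (m (x - y)%R * g x)%:E).
    exact: (integrable_kernel_r x (psi := fun=> g x) (C := `|g x|%R)).
  have gxE : (g x)%:E = \int[mu]_y (m (x - y)%R * g x)%:E.
    under eq_integral do rewrite EFinM muleC.
    rewrite integralZl//; first by rewrite integral_kernel_r mule1.
    exact: integrable_kernel_at.
  rewrite -abse_EFin EFinB -Fx gxE /F /fubini_F -integralB//.
  apply: le_trans (le_abse_integral _ _ _) _ => //.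
    by apply: emeasurable_funB; [exact: measurable_int iKx|exact: measurable_int igx].
  rewrite le_eqVlt; apply/orP; left; apply/eqP; apply: eq_integral => y _.
  by rewrite /K /D /= -mulrBr normrM ger0_norm.
rewrite (fubini_tonelli D mD D0).
pose E (z : 'rV[R]_n * 'rV[R]_n) : \bar R := (m z.1 * `|g (z.2 + z.1)%R - g z.2|)%:E.
have mE : measurable_fun setT E.
  apply/measurable_EFinP; apply: measurable_funM; first exact: (measurableT_comp mm).
  apply: measurableT_comp => //; apply: measurable_funB; last exact: mg2.
  apply: (measurableT_comp mg); apply: measurable_fun_rVP => i.
  under eq_fun do rewrite mxE.
  by apply: measurable_funD; apply: (measurableT_comp (@measurable_coord R n i)).
have E0 z : 0 <= E z by rewrite lee_fin mulr_ge0.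
rewrite [leLHS](_ : _ = \int[mu]_y \int[mu]_h E (h, y)).
  rewrite -(fubini_tonelli E mE E0) le_eqVlt; apply/orP; left; apply/eqP.
  apply: eq_integral => h _; rewrite /shift_dist -ge0_integralZl//.
    by apply: measurable_dist => //; exact: measurable_comp_shift.
  by rewrite lee_fin.
apply: eq_integral => y _.
have mDy : measurable_fun setT (fun x => D (x, y)).
  by apply: (measurableT_comp mD); exact: pair2_measurable.
rewrite -(ge0_integral_shift y mDy (fun x => D0 (x, y))).
by apply: eq_integral => x _; rewrite /D /E/= addrK distrC (addrC x).
Qed.

Lemma measurable_shift_dist : measurable_fun setT (shift_dist g).
Proof.
pose E (z : 'rV[R]_n * 'rV[R]_n) : \bar R := (`|g (z.2 + z.1)%R - g z.2|)%:E.
have mE : measurable_fun setT E.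
  apply/measurable_EFinP.
  apply: measurableT_comp => //; apply: measurable_funB; last exact: mg2.
  apply: (measurableT_comp mg); apply: measurable_fun_rVP => i.
  under eq_fun do rewrite mxE.
  by apply: measurable_funD; apply: (measurableT_comp (@measurable_coord R n i)).
by apply: (measurable_fun_fubini_tonelli_F E mE) => z; rewrite lee_fin.
Qed.

Lemma integral_kernel_shift_dist (e d : R) : (0 <= e)%R ->
  (forall h, (enorm h < d)%R -> shift_dist g h <= e%:E) ->
  \int[mu]_h ((m h)%:E * shift_dist g h) <=
  e%:E + (\int[mu]_x (`|g x|%R)%:E + \int[mu]_x (`|g x|%R)%:E) *
    \int[mu]_(h in ~` eball d) (m h)%:E.
Proof.
move=> e0 gd; set N := (_ + \int[mu]_x _).
have N0 : 0 <= N by rewrite adde_ge0// integral_ge0.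
have mC : measurable (~` @eball R n d) by apply: measurableC; exact: measurable_eball.
have mmE (D : set 'rV[R]_n) : measurable_fun D (EFin \o m).
  by apply: measurable_funTS; exact/measurable_EFinP.
(* the right-hand side is the integral of m (e + N 1_(|h| >= d)), and the
   integrands compare pointwise *)
rewrite -[X in X + _]mule1 -m_mass -ge0_integralZl//; last by move=> *; rewrite lee_fin.
rewrite -ge0_integralZl//; last by move=> *; rewrite lee_fin.
rewrite [X in _ <= _ + X]integral_mkcond -ge0_integralD//; first last.
- by apply/measurable_restrict => //; apply: measurable_funTS; exact: measurable_funeM.
- move=> h _; rewrite patchE; case: ifP => // _.
  by rewrite mule_ge0// lee_fin.
- exact: measurable_funeM.
- by move=> h _; rewrite mule_ge0// lee_fin.
apply: ge0_le_integral => //.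
- by move=> h _; rewrite mule_ge0 ?lee_fin//; exact: integral_ge0.
- apply: emeasurable_funM; [exact/measurable_EFinP|exact: measurable_shift_dist].
- apply: emeasurable_funD; first exact: measurable_funeM.
  by apply/measurable_restrict => //; apply: measurable_funTS; exact: measurable_funeM.
move=> h _; rewrite patchE; have [hC|hC] := boolP (h \in _).
  apply: (@le_trans _ _ (N * (m h)%:E)).
    by rewrite muleC lee_wpmul2r ?lee_fin//; exact: shift_dist_le2.
  by rewrite leeDr// mule_ge0// lee_fin.
rewrite adde0 muleC lee_wpmul2r ?lee_fin//; apply: gd.
by move: hC; rewrite in_setC negbK => /set_mem.
Qed.

End mollification.

(** * Test functions and vector-valued integrable functions *)

Section test_functions.
Context {R : realType} {n : nat} {W : vectType R}.
Variable psi : 'rV[R]_n -> W.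
Hypothesis tpsi : test_function psi.
Local Notation b := (vbasis {:W}).

Lemma continuous_test_function j : continuous (fun x => coord b j (psi x)).
Proof.
move=> x; apply: differentiable_continuous.
by have [/(_ j [::] x)] := tpsi.
Qed.

Lemma bounded_test_function j :
  exists C : R, forall x, `|coord b j (psi x)| <= C.
Proof.
have [_ cK] := tpsi; set K := closure _ in cK.
pose f x : R^o := coord b j (psi x).
have : compact (f @` K).
  apply: continuous_compact => //; apply: continuous_subspaceT => x.
  exact: continuous_test_function.
move=> /compact_bounded[M [_ KM]]; exists (`|M| + 1) => x.
have [px|px] := eqVneq (psi x) 0.
  by rewrite px linear0 normr0 addr_ge0.
apply: (KM (`|M| + 1)); first by rewrite ltr_pwDr// ler_norm.
by exists x => //; apply: subset_closure.
Qed.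

End test_functions.

Section L1_coordinates.
Context {R : realType} {n : nat} {W : vectType R}.
Variable ip : {dot W for @idfun R}.
Implicit Types g : 'rV[R]_n -> W.
Local Notation b := (vbasis {:W}).
Local Notation mu := (leb n).

Lemma measurable_dot g k :
  (forall j, measurable_fun setT (fun x => coord b j (g x))) ->
  (forall j, measurable_fun setT (fun x => coord b j (k x))) ->
  measurable_fun setT (fun x : 'rV[R]_n => ip (g x) (k x)).
Proof.
move=> mg mk; under eq_fun do rewrite ip_coord.
apply: measurable_sum => i; apply: measurable_sum => j.
by apply: measurable_funM => //; exact: measurable_funM.
Qed.

Lemma measurable_vnorm g :
  (forall j, measurable_fun setT (fun x => coord b j (g x))) ->
  measurable_fun setT (fun x => vnorm ip (g x)).
Proof.
move=> mg; apply: (@measurableT_comp _ _ _ _ _ _ (@Num.sqrt R)).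
  by apply: continuous_measurable_fun; exact: sqrt_continuous.
exact: measurable_dot.
Qed.

Lemma L1normE g : L1norm ip g = (\int[mu]_x (vnorm ip (g x))%:E)%E.
Proof.
rewrite /L1norm Lnorm1; apply: eq_integral => x _.
by rewrite /= ger0_norm ?vnorm_ge0.
Qed.

Lemma L1_integrable g j : L1 ip g ->
  mu.-integrable setT (fun x => (coord b j (g x))%:E).
Proof.
move=> [mg]; rewrite L1normE => goo.
have [C C0 CP] := coord_le_vnorm ip.
have mv := measurable_vnorm mg.
have iv : mu.-integrable setT (fun x => C%:E * (vnorm ip (g x))%:E)%E.
  apply: integrableZl => //; apply/integrableP; split; first exact/measurable_EFinP.
  by under eq_integral do rewrite gee0_abs ?lee_fin ?vnorm_ge0//.
apply: le_integrable iv => //; first exact/measurable_EFinP.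
move=> x _; rewrite -EFinM !abse_EFin lee_fin.
by rewrite (le_trans (CP j (g x)))// ler_norm.
Qed.

Lemma L1norm_le_coord : exists2 C : R, 0 <= C & forall g,
  (forall j, measurable_fun setT (fun x => coord b j (g x))) ->
  (L1norm ip g <= C%:E * \sum_j \int[mu]_x `|coord b j (g x)|%:E)%E.
Proof.
have [C C0 CP] := vnorm_le_coord ip; exists C => // g mg.
have mabs j : measurable_fun setT (fun x => (`|coord b j (g x)|%:E)).
  by apply/measurable_EFinP; exact: measurableT_comp.
rewrite L1normE -ge0_integral_sum// -ge0_integralZl//; last 2 first.
- exact: emeasurable_sum.
- by move=> x _; apply: sume_ge0 => j _; rewrite lee_fin.
apply: ge0_le_integral => //.
- by move=> x _; rewrite lee_fin vnorm_ge0.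
- by apply/measurable_EFinP; exact: measurable_vnorm.
- by apply: measurable_funeM; exact: emeasurable_sum.
by move=> x _; rewrite sumEFin -EFinM lee_fin.
Qed.

Lemma integrable_L1 g :
  (forall j, mu.-integrable setT (fun x => (coord b j (g x))%:E)) -> L1 ip g.
Proof.
move=> ig.
have mg j : measurable_fun setT (fun x => coord b j (g x)).
  by apply/measurable_EFinP; exact: measurable_int (ig j).
split => //; have [C C0 CP] := L1norm_le_coord.
apply: (le_lt_trans (CP g mg)).
have H : (0 <= \sum_j \int[mu]_x `|coord b j (g x)|%:E < +oo)%E.
  elim/big_ind : _ => [|x y /andP[x0 xoo] /andP[y0 yoo]|j _].
  - by rewrite lexx ltry.
  - by rewrite adde_ge0// lte_add_pinfty.
  - rewrite integral_ge0//=.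
    by have /integrableP[] := ig j.
by have /andP[? ?] := H; rewrite lte_mul_pinfty ?lee_fin.
Qed.

End L1_coordinates.

(** * Approximate identities in L1(R^n; W) *)

Section vector_mollification.
Context {R : realType} {n : nat} {W : vectType R}.
Variable ip : {dot W for @idfun R}.
Local Notation b := (vbasis {:W}).
Local Notation mu := (leb n).

Lemma coord_vbasis_sum (c : 'I_(\dim {:W}) -> R) j :
  coord b j (\sum_i c i *: b`_i) = c j.
Proof. exact: coord_sum_free (basis_free (vbasisP {:W})). Qed.

Definition vmollify (m : 'rV[R]_n -> R) (g : 'rV[R]_n -> W) (x : 'rV[R]_n) : W :=
  \sum_j mollify m (fun y => coord b j (g y)) x *: b`_j.

Lemma coord_convolution (m : 'rV[R]_n -> R) (psi : 'rV[R]_n -> W) x j :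
  coord b j (convolution m psi x) =
  fine (\int[mu]_y (m (x - y) * coord b j (psi y))%:E)%E.
Proof.
rewrite coord_vbasis_sum; congr fine; apply: eq_integral => y _.
by rewrite linearZ.
Qed.

Variables (m : 'rV[R]_n -> R) (g : 'rV[R]_n -> W).
Hypotheses (mm : measurable_fun setT m) (m_ge0 : forall x, 0 <= m x).
Hypotheses (m_mass : (\int[leb n]_x (m x)%:E = 1)%E) (m_even : forall x, m (- x) = m x).
Hypothesis ig : L1 ip g.

Lemma vmollify_L1 : L1 ip (vmollify m g).
Proof.
apply: integrable_L1 => j; under eq_fun do rewrite coord_vbasis_sum.
by apply: integrable_mollify => //; exact: L1_integrable ig.
Qed.

(** The scalar duality applied to each pair of coordinates in the expansion of
    the inner product over the basis. *)
Lemma vmollify_duality (psi : 'rV[R]_n -> W) : test_function psi ->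
  (\int[mu]_x ip (g x) (convolution m psi x) =
   \int[mu]_x ip (vmollify m g x) (psi x))%R.
Proof.
move=> tpsi.
have mpsi i : measurable_fun setT (fun x => coord b i (psi x)).
  by apply: continuous_measurable_rV; exact: continuous_test_function.
have igi i := L1_integrable i ig.
congr fine.
under eq_integral do rewrite ip_coord -sumEFin.
under [RHS]eq_integral do rewrite ip_coord -sumEFin.
have iconv i j : mu.-integrable setT (fun x =>
    (coord b i (g x) * coord b j (convolution m psi x))%:E).
  have [C psiC] := bounded_test_function tpsi j.
  under eq_fun do rewrite coord_convolution.
  exact: (@integrable_test_mollified _ _ m _ mm m_ge0 m_mass (igi i) _ C (mpsi j) psiC).
have imol i j : mu.-integrable setT (fun x =>
    (coord b i (vmollify m g x) * coord b j (psi x))%:E).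
  have [C psiC] := bounded_test_function tpsi j.
  under eq_fun do rewrite coord_vbasis_sum.
  exact: (@integrable_mollify_test _ _ m _ mm m_ge0 m_mass (igi i) _ C (mpsi j) psiC).
under eq_integral => x _.
  under eq_bigr => i _ do (rewrite -sumEFin; under eq_bigr => j _ do rewrite EFinM).
  over.
under [RHS]eq_integral => x _.
  under eq_bigr => i _ do (rewrite -sumEFin; under eq_bigr => j _ do rewrite EFinM).
  over.
have isum (h : 'I_(\dim {:W}) -> 'I_(\dim {:W}) -> 'rV[R]_n -> R) :
    (forall i j, mu.-integrable setT (fun x => (h i j x)%:E)) ->
    (\int[mu]_x \sum_i \sum_j ((h i j x)%:E * (ip b`_i b`_j)%:E) =
     \sum_i \sum_j (\int[mu]_x (h i j x)%:E) * (ip b`_i b`_j)%:E)%E.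
  move=> ih.
  have ihk i j : mu.-integrable setT (fun x => (h i j x)%:E * (ip b`_i b`_j)%:E)%E.
    exact: integrableZr.
  rewrite integral_sum//; last by move=> i; exact: integrable_sum.
  apply: eq_bigr => i _; rewrite integral_sum//.
  by apply: eq_bigr => j _; rewrite integralZr.
rewrite !isum//.
apply: eq_bigr => i _; apply: eq_bigr => j _; congr (_ * _)%E.
have [C psiC] := bounded_test_function tpsi j.
under eq_integral do rewrite coord_convolution.
under [RHS]eq_integral do rewrite coord_vbasis_sum.
exact: (@mollify_duality _ _ m _ mm m_ge0 m_mass (igi i) m_even _ C (mpsi j) psiC).
Qed.

End vector_mollification.

Section approximation.
Context {R : realType} {n : nat} {W : vectType R}.
Variable ip : {dot W for @idfun R}.
Local Notation b := (vbasis {:W}).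
Local Notation mu := (leb n).
Variables (m : R -> 'rV[R]_n -> R) (g : 'rV[R]_n -> W).
Hypotheses (mm : forall e, 0 < e -> measurable_fun setT (m e))
  (m_ge0 : forall e, 0 < e -> forall x, 0 <= m e x)
  (m_mass : forall e, 0 < e -> (\int[leb n]_x (m e x)%:E = 1)%E).
Hypothesis m_conc : forall d : R, 0 < d ->
  (\int[mu]_(h in ~` eball d) (m e h)%:E)%E @[e --> 0^'+] --> 0%E.
Hypothesis ig : L1 ip g.

Lemma mollify_cvg (f : 'rV[R]_n -> R) : mu.-integrable setT (EFin \o f) ->
  forall eta : R, 0 < eta -> \forall e \near 0^'+,
    (\int[mu]_x `|mollify (m e) f x - f x|%:E <= eta%:E)%E.
Proof.
move=> fi eta eta0; have mf : measurable_fun setT f.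
  by apply/measurable_EFinP; exact: measurable_int fi.
have eta2 : 0 < eta / 2 by rewrite divr_gt0.
have [d d0 fd] := shift_continuous_L1 fi eta2.
pose N := (\int[mu]_x `|f x|%:E + \int[mu]_x `|f x|%:E)%E.
have N0 : (0 <= N)%E by rewrite adde_ge0// integral_ge0.
have Nfin : N \is a fin_num.
  have /integrableP[_ foo] := fi.
  by rewrite ge0_fin_numE// lte_add_pinfty.
pose N' := fine N.
have N'0 : 0 <= N' by rewrite fine_ge0.
have c0 : 0 < eta / 2 / (N' + 1) by rewrite divr_gt0// ltr_wpDl.
have tail := cvge0_near_lt (m_conc d0) c0.
near=> e; have e0 : 0 < e by near: e; exact: nbhs_right_gt.
apply: (le_trans (mollify_dist_le (mm e0) (m_ge0 e0) (m_mass e0) fi)).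
apply: (le_trans (integral_kernel_shift_dist (mm e0) (m_ge0 e0) (m_mass e0)
  fi (ltW eta2) fd)).
rewrite -/N -(fineK Nfin) -/N'.
have te : (\int[mu]_(h in ~` eball d) (m e h)%:E <= (eta / 2 / (N' + 1))%:E)%E.
  by apply: ltW; near: e; exact: tail.
apply: (@le_trans _ _ ((eta / 2)%:E + N'%:E * (eta / 2 / (N' + 1))%:E)%E).
  by apply: leeD => //; apply: lee_wpmul2l.
rewrite -EFinM -EFinD lee_fin.
have : N' * (eta / 2 / (N' + 1)) <= eta / 2.
  rewrite mulrA ler_pdivrMr ?ltr_wpDl// mulrC ler_wpM2l ?(ltW eta2)//.
  by rewrite lerDl.
lra.
Unshelve. all: by end_near. Qed.

Lemma vmollify_cvg :
  L1norm ip (fun x => vmollify (m e) g x - g x) @[e --> 0^'+] --> 0%E.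
Proof.
have [C C0 CP] := @L1norm_le_coord R n W ip.
apply: cvge0_le => [e|eta eta0].
  by rewrite L1normE integral_ge0// => x _; rewrite lee_fin vnorm_ge0.
pose D : R := (\dim {:W})%:R.
have c0 : 0 < eta / (C * D + 1) by rewrite divr_gt0// ltr_wpDl// mulr_ge0.
have H : \forall e \near 0^'+, forall j,
   (\int[mu]_x `|mollify (m e) (fun y => coord b j (g y)) x - coord b j (g x)|%:E
     <= (eta / (C * D + 1))%:E)%E.
  by apply: filter_forall => j; apply: mollify_cvg => //; exact: L1_integrable ig.
near=> e; have e0 : 0 < e by near: e; exact: nbhs_right_gt.
have coordE j x : coord b j (vmollify (m e) g x - g x) =
    mollify (m e) (fun y => coord b j (g y)) x - coord b j (g x).
  by rewrite linearB/= coord_vbasis_sum.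
apply: (le_trans (CP _ _)) => [j|].
  under eq_fun do rewrite coordE; apply: measurable_funB; last exact: ig.1.
  apply: measurable_mollify => //;
    [exact: mm|exact: m_ge0|exact: m_mass|exact: L1_integrable ig].
apply: (@le_trans _ _ (C%:E * \sum_(j < \dim {:W}) (eta / (C * D + 1))%:E)%E).
  apply: lee_wpmul2l; first by rewrite lee_fin.
  apply: lee_sum => j _; under eq_integral do rewrite coordE.
  by move: j {coordE}; near: e; exact: H.
rewrite sumEFin -EFinM lee_fin sumr_const card_ord -mulr_natr -/D.
have CD : 0 < C * D + 1 by rewrite ltr_wpDl// mulr_ge0.
rewrite [leLHS](_ : _ = eta * (C * D) / (C * D + 1)); last by ring.
by rewrite ler_pdivrMr// ler_wpM2l ?(ltW eta0)// lerDl.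
Unshelve. all: by end_near. Qed.

End approximation.

(** * The convergence theorem *)

Section radial_profile.
Context {R : realType} {n : nat}.
Variables (rho : 'rV[R]_n -> R) (rhohat : R -> R).

Lemma enorm_delta_mx (i : 'I_n) : enorm (delta_mx ord0 i : 'rV[R]_n) = 1.
Proof.
rewrite /enorm (bigD1 i)//= big1 ?addr0 => [|j ji]; rewrite !mxE eqxx/=.
  by rewrite eqxx expr1n sqrtr1.
by rewrite (negbTE ji) expr0n.
Qed.

(** The values of rhohat at negative radii are arbitrary, so rhohat need not be
    measurable on the line; restricting rho to a coordinate axis gives a
    measurable nonnegative function that agrees with rhohat where it matters. *)
Definition profile (i : 'I_n) (r : R) : R := rho (r *: delta_mx ord0 i).

Hypothesis rho_radial : forall x, rho x = rhohat (enorm x).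

Lemma profile_rhohat i r : profile i r = rhohat `|r|.
Proof. by rewrite /profile rho_radial enormZ enorm_delta_mx mulr1. Qed.

Lemma profile_enorm i x : profile i (enorm x) = rho x.
Proof. by rewrite profile_rhohat ger0_norm ?enorm_ge0// rho_radial. Qed.

Lemma measurable_profile i : measurable_fun setT rho ->
  measurable_fun setT (profile i).
Proof.
move=> mrho; apply: (measurableT_comp mrho); apply: measurable_fun_rVP => j.
under eq_fun do rewrite !mxE; exact: mulrr_measurable.
Qed.

Lemma mu_rho_profile i : mu_rho rhohat = mu_rho (profile i) :> ('rV[R]_n -> R).
Proof.
apply/funext => x; apply: eq_Rintegral => r.
rewrite inE/= in_itv/= andbT => r0.
by rewrite profile_rhohat gtr0_norm.
Qed.

End radial_profile.

Theorem corollary2p13 (R : realType) (n : nat) (n_gt0 : (0 < n)%N)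
    (V W : vectType R)
    (ipV : {dot V for @idfun R}) (ipW : {dot W for @idfun R})
    (A : 'I_n -> 'Hom(V, W))
    (rho : R -> 'rV[R]_n -> R) (rhohat : R -> R -> R)
    (rho_radial : forall e : R, 0 < e -> forall x, rho e x = rhohat e (enorm x))
    (rho_ge0 : forall e : R, 0 < e -> forall x, 0 <= rho e x)
    (rho_L1 : forall e : R, 0 < e ->
       (leb n).-integrable [set: 'rV[R]_n] (EFin \o rho e))
    (rho_norm1 : forall e : R, 0 < e -> Lnorm (leb n) 1%:E (EFin \o rho e) = 1%:E)
    (rho_conc : forall delta : R, 0 < delta ->
       (\int[leb n]_(x in ~` eball delta) `|rho e x|%:E)%E
         @[e --> 0^'+] --> 0%E)
    (T : ('rV[R]_n -> V) -> R) (T_distr : is_distribution T)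
    (AT_L1 : exists g, L1_density ipW (calA ipV ipW A T) g) :
  L1_cvg0 ipW (fun e => frakA ipV ipW A (rhohat e) T) (calA ipV ipW A T).
Proof.
pose g := density ipW (calA ipV ipW A T).
have gE : L1_density ipW (calA ipV ipW A T) g by exact: (xgetPex (fun=> 0) AT_L1).
have gL1 : L1 ipW g by case: gE.
pose i0 := Ordinal n_gt0.
pose phi e := profile (rho e) i0.
pose m e : 'rV[R]_n -> R := mu_rho (rhohat e).
have mE e : 0 < e -> m e = mu_rho (phi e).
  by move=> e0; apply: mu_rho_profile; exact: rho_radial.
have phiE e : 0 < e -> forall x, phi e (enorm x) = rho e x.
  by move=> e0; apply: profile_enorm; exact: rho_radial.
have phi_ge0 e : 0 < e -> forall r, 0 <= phi e r by move=> e0 r; exact: rho_ge0.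
have mphi e : 0 < e -> measurable_fun setT (phi e).
  move=> e0; apply: measurable_profile.
  by apply/measurable_EFinP; exact: (measurable_int _ (rho_L1 e e0)).
have phi_mass e : 0 < e -> (\int[leb n]_x (phi e (enorm x))%:E = 1)%E.
  move=> e0; rewrite -(rho_norm1 e e0) Lnorm1; apply: eq_integral => x _.
  by rewrite phiE//= ger0_norm// rho_ge0.
have mm e : 0 < e -> measurable_fun setT (m e).
  by move=> e0; rewrite mE//; apply: measurable_mu_rho; [exact: mphi|exact: phi_ge0].
have m_ge0 e : 0 < e -> forall x, 0 <= m e x.
  by move=> e0 x; rewrite mE//; apply: mu_rho_ge0; exact: phi_ge0.
have m_mass e : 0 < e -> (\int[leb n]_x (m e x)%:E = 1)%E.
  move=> e0; rewrite mE//; apply: integral_mu_rho => //;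
    [exact: mphi|exact: phi_ge0|exact: phi_mass].
have m_even e : 0 < e -> forall x, m e (- x) = m e x.
  by move=> e0 x; rewrite mE//; exact: mu_rhoN.
have m_conc (d : R) : 0 < d ->
    (\int[leb n]_(h in ~` eball d) (m e h)%:E)%E @[e --> 0^'+] --> 0%E.
  move=> d0; apply: squeeze_cvge (cvg_cst 0%E) (rho_conc d d0).
  near=> e; have e0 : 0 < e by near: e; exact: nbhs_right_gt.
  rewrite integral_ge0 => [|x _]; last by rewrite lee_fin m_ge0.
  rewrite mE//=; apply: (le_trans (integral_mu_rho_tail n_gt0 _ _ d)).
  - exact: mphi.
  - exact: phi_ge0.
  rewrite le_eqVlt; apply/orP; left; apply/eqP; apply: eq_integral => x _.
  by rewrite phiE// ger0_norm// rho_ge0.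
exists (fun e => vmollify (m e) g), g; split => //.
  move=> e e0; split.
    by apply: vmollify_L1 => //; [exact: mm|exact: m_ge0|exact: m_mass].
  move=> psi tpsi.
  apply: (vmollify_duality _ _ _ _ gL1 tpsi).
  - exact: mm.
  - exact: m_ge0.
  - exact: m_mass.
  - exact: m_even.
exact: (vmollify_cvg mm m_ge0 m_mass m_conc gL1).
Unshelve. all: by end_near. Qed.
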